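(* Let $f(t)\in\mathbb F_{q^d}(t)$ be a rational function. Write $f(t)=\prod_{j=1}^k f_j(t)^{n_j}$, where $f_j(t)\in\mathbb F_{q^d}[t]$ are irreducible polynomials and $n_j$ are nonzero integers. Let $\chi:\mathbb F_{q^d}^\ast\to\overline{\mathbb Q}_\ell^\ast$ be a multiplicative character of $\mathbb F_{q^d}$. Suppose that the rational function $\prod_{i=0}^{d-1}f(t^{q^i})$ is not of the form $h(t)^{\mathrm{ord}(\chi)}$ with $h(t)\in\mathbb F(t)$. Then $$\bigg|\sum_{a\in \mathbb F_q,\; f(a)\not=0,\infty}\chi(f(a))\bigg|\leq \Big(d\sum_{j=1}^k \deg(f_j)-1\Big)\sqrt{q}.$$
   Context: $p$ is a prime number, $\mathbb F$ is an algebraic closure of $\mathbb F_p$, $q$ is a power of $p$, $d\geq 1$ is an integer, and $\mathbb F_q\subset\mathbb F_{q^d}\subset\mathbb F$ are the subfields with $q$ and $q^d$ elements. $\ell$ is a prime number distinct from $p$. A multiplicative character is a group homomorphism $\chi:\mathbb F_{q^d}^\ast\to\overline{\mathbb Q}_\ell^\ast$, and $\mathrm{ord}(\chi)$ is the smallest positive integer $e$ such that $\chi^e=1$. The sum is over those $a$ in the subfield $\mathbb F_q$ at which $f$ has neither a zero nor a pole. $|\cdot|$ denotes the Archimedean absolute value, taken via any field isomorphism $\overline{\mathbb Q}_\ell\cong\mathbb C$ (equivalently, one may regard $\chi$ as complex valued). *)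

(* Defs.v *)
From mathcomp Require Export all_boot all_order all_algebra reals.
From mathcomp Require Export complex.

Set Implicit Arguments.
Unset Strict Implicit.
Unset Printing Implicit Defensive.

Import GRing.Theory.
Local Open Scope ring_scope.
Local Open Scope quotient_scope.

Section RationalFunctions.
Variable K : fieldType.
Implicit Types f : {fraction {poly K}}.

(* [repr f] need not be in lowest terms, hence the division by the gcd; the
   numerator and denominator below are coprime, and unique up to a common
   nonzero scalar. *)
Definition rf_num f : {poly K} :=
  \n_(repr f) %/ gcdp \n_(repr f) \d_(repr f).
Definition rf_den f : {poly K} :=
  \d_(repr f) %/ gcdp \n_(repr f) \d_(repr f).

Lemma rf_den_neq0 f : rf_den f != 0.
Proof.
have d0 := denom_ratioP (repr f).
by rewrite /rf_den dvdp_div_eq0 ?dvdp_gcdr.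
Qed.

Lemma rf_numden f :
  f = FracField.tofrac (rf_num f) / FracField.tofrac (rf_den f).
Proof.
have d0 := denom_ratioP (repr f).
have g0 : gcdp \n_(repr f) \d_(repr f) != 0 by rewrite gcdp_eq0 negb_and d0 orbT.
have fd : FracField.tofrac \n_(repr f) = f * FracField.tofrac \d_(repr f).
  rewrite -{2}[f]reprK; unlock FracField.tofrac.
  rewrite -[RHS]FracField.pi_mul; apply/eqP; rewrite FracField.equivf_def.
  by rewrite /FracField.mulf !numden_Ratio ?mulf_neq0 ?oner_neq0 // !mulr1 mul1r.
have g0F : FracField.tofrac (gcdp \n_(repr f) \d_(repr f)) != 0.
  by rewrite tofrac_eq0.
apply: (mulIf (x := FracField.tofrac (rf_den f))).
  by rewrite tofrac_eq0 rf_den_neq0.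
rewrite divfK ?tofrac_eq0 ?rf_den_neq0 //; apply: (mulIf g0F).
by rewrite -mulrA -!tofracM !divpK ?dvdp_gcdl ?dvdp_gcdr.
Qed.

Lemma rf_coprime f : coprimep (rf_num f) (rf_den f).
Proof.
have d0 := denom_ratioP (repr f).
by rewrite /rf_num /rf_den coprimep_div_gcd // d0 orbT.
Qed.

Definition rf_zero f (a : K) : bool := root (rf_num f) a.
Definition rf_pole f (a : K) : bool := root (rf_den f) a.

(* The value of f at a; meaningful when a is not a pole of f. *)
Definition rf_eval f (a : K) : K := (rf_num f).[a] / (rf_den f).[a].

(* f(t^n), for n > 0. *)
Definition rf_subst_exp (n : nat) f : {fraction {poly K}} :=
  FracField.tofrac (rf_num f \Po 'X^n) / FracField.tofrac (rf_den f \Po 'X^n).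

End RationalFunctions.

(* The image of f in F(t), for an embedding K -> F. *)
Definition rf_map (K F : fieldType) (iota : {rmorphism K -> F})
    (f : {fraction {poly K}}) : {fraction {poly F}} :=
  FracField.tofrac (map_poly iota (rf_num f)) /
  FracField.tofrac (map_poly iota (rf_den f)).

(* Homomorphisms K^* -> E^*, represented by functions on K whose value at 0 is
   irrelevant. *)
Definition is_mulchar (K E : fieldType) (chi : K -> E) : Prop :=
  (forall x, x != 0 -> chi x != 0) /\
  (forall x y, x != 0 -> y != 0 -> chi (x * y) = chi x * chi y).

Definition is_mulchar_ord (K E : fieldType) (chi : K -> E) (e : nat) : Prop :=
  [/\ (0 < e)%N,
      forall x, x != 0 -> chi x ^+ e = 1
    & forall e' : nat, (0 < e')%N ->
        (forall x, x != 0 -> chi x ^+ e' = 1) -> (e <= e')%N].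

(* Main.v *)
Require Import Defs.
From HB Require Import structures.
From mathcomp Require Import qpoly finfield cyclic separable perm.
From mathcomp Require Import ring zify.
Import Order.TTheory GRing.Theory Num.Theory.
Set Implicit Arguments.
Unset Strict Implicit.
Unset Printing Implicit Defensive.
Local Open Scope ring_scope.
Local Notation tofrac := FracField.tofrac.

(** The bound is the Riemann hypothesis for the L-function of the character
    [chi (f a)], proved by elementary means: the L-function shows that the sum
    is minus a sum of few complex numbers, and Stepanov's method bounds each of
    them.

    Replace [f = num / den] by the polynomial [P = num * den ^ (e - 1)], where
    [e] is the order of [chi]; this does not change the value of [chi] and turns
    the poles into zeros.  Let [Q = q ^ d].  For every [r > 0] consider
      S_r = sum over the a with a ^ (q ^ r) = a of
              chi (P a * P (a ^ q) * ... * P (a ^ (q ^ (r - 1)))),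
    so that [S_1] is the sum to be bounded.

    The product of the values of [P] at the roots of a monic polynomial [g]
    over the field with [q] elements is multiplicative in [g]; let [L_n] be the
    sum of [chi] of this product over all [g] of degree [n].  Counting, for
    each [g], the points whose Frobenius cycle divides [g] gives the Newton
    identities [n L_n = S_1 L_(n-1) + ... + S_n L_0] ([Lcoef_newton]).  By
    reciprocity the product depends, up to a factor depending on [n] only, on
    [g] modulo a polynomial [M] over the small field that vanishes at the zeros
    of [P].  Unless the induced character of the residues modulo [M] is
    trivial, [L_n] vanishes for [n] at least the degree [D] of [M]
    ([Lcoef_vanish]), and [D] can be taken to be [d] times the degree of the
    product of the [f_j] ([conjugate_product]).  Hence there are fewer than [D]
    complex numbers [w] such that [S_r = - sum of w ^ r] for all [r > 0]
    ([newton_unique]).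

    When [d] divides [r], the product in [S_r] is a power of
    [G a = P a * P (a ^ q) * ... * P (a ^ (q ^ (d - 1)))], so [S_r] is an
    ordinary character sum for [G] over the field with [q ^ r] elements.  As [G]
    is not an [e]-th power over the algebraic closure, [G = H ^ k] with
    [e = k * n], [n > 1], where [H] is not an [m]-th power for any [m > 1]
    dividing [n].  For fields with [w ^ 2] elements Stepanov's method
    ([stepanov_bound]) shows that [H] raised to the [(w ^ 2 - 1) / n] takes each
    value at most [w ^ 2 / n + O(w)] times.  The [n] possible values exhaust
    all but boundedly many points, hence they are equidistributed up to
    [O(w)], and [S_r = O(q ^ (r / 2))] along a sequence of multiples
    ([large_sum_bound], [char_sum_growth]).

    This estimate is used twice.  It excludes the trivial character modulo [M],
    for which [S_r] would have absolute value close to [q ^ r]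
    ([nontrivial_residue]); and, since a sum of powers cannot grow
    more slowly than its largest term ([power_sum_bound]), it shows
    that every [w] has absolute value at most the square root of [q].  As there
    are at most [D - 1] of them, the bound for [S_1] follows. *)

(** * Independence of the powers of a high power *)

Lemma size_mul_bound (R : nzRingType) (u v : {poly R}) (a b : nat) :
  (size u <= a.+1)%N -> (size v <= b.+1)%N -> (size (u * v)%R <= (a + b).+1)%N.
Proof.
move=> ua vb; apply: leq_trans (size_polyMleq _ _) _.
by rewrite -subn1 leq_subLR; apply: leq_trans (leq_add ua vb) _; lia.
Qed.

Lemma size_prod_bound (R : nzRingType) (I : Type) (r : seq I)
    (F : I -> {poly R}) (b : I -> nat) :
  (forall i, (size (F i) <= (b i).+1)%N) ->
  (size (\prod_(i <- r) F i)%R <= (\sum_(i <- r) b i).+1)%N.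
Proof.
move=> Fb; elim: r => [|i r IHr]; first by rewrite !big_nil size_poly1.
by rewrite !big_cons; apply: size_mul_bound.
Qed.

Lemma size_sum_bound (R : nzRingType) (I : Type) (r : seq I) (P : pred I)
    (F : I -> {poly R}) (b : nat) :
  (forall i, P i -> (size (F i) <= b)%N) ->
  (size (\sum_(i <- r | P i) F i)%R <= b)%N.
Proof.
move=> Fb; elim/big_ind: _ => [|u v ub vb|//]; first by rewrite size_poly0.
by apply: leq_trans (size_polyD _ _) _; rewrite geq_max ub.
Qed.

Lemma size_det_bound (R : comNzRingType) n (A : 'M[{poly R}]_n) (b : 'I_n -> nat) :
  (forall i j, (size (A i j) <= (b i).+1)%N) ->
  (size (\det A)%R <= (\sum_i b i).+1)%N.
Proof.
move=> Ab; apply: size_sum_bound => s _; rewrite -signr_odd.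
have := size_prod_bound (index_enum 'I_n) (fun i => Ab i ((s : {perm _}) i)).
by case: (odd _); rewrite (expr1, expr0) (mulN1r, mul1r) ?size_polyN.
Qed.

(** The norm of a root of [p]: the companion matrix [A] of [p] satisfies
    [A ^ n = w], and [u] is its determinant. *)
Lemma dvdp_Xn_sub_norm (L : fieldType) n (w : L) (p : {poly L}) :
  p %| 'X^n - w%:P -> exists u, u ^+ n = w ^+ (size p).-1.
Proof.
have [sp0|sp_gt0] := posnP (size p).-1.
  by move=> _; exists 1; rewrite sp0 expr1n.
have p0 : p != 0 by apply: contraTneq sp_gt0 => ->; rewrite size_poly0.
set q := (lead_coef p)^-1 *: p => pdvd.
have lp0 : (lead_coef p)^-1 != 0 by rewrite invr_eq0 lead_coef_eq0.
have qdvd : q %| 'X^n - w%:P by rewrite (eqp_dvdl _ (eqp_scale _ lp0)).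
have sq : size q = size p by rewrite size_scale.
have qm : q \is monic by rewrite monicE lead_coefZ mulVf // lead_coef_eq0.
rewrite -sq in sp_gt0 *; clearbody q => {p p0 pdvd lp0 sq}.
have := companionmxK qm; move: (companionmx q) qdvd.
case: _.-1 sp_gt0 => // s _ A /dvdpP [h hE] Aq; exists (\det A).
have : horner_mx A ('X^n - w%:P) = 0.
  by rewrite hE rmorphM /= -Aq Cayley_Hamilton mulr0.
rewrite rmorphB rmorphXn /= horner_mx_X horner_mx_C => /subr0_eq An.
have := congr1 determinant An; rewrite det_scalar => <-.
by elim: (n) => [|k IHk]; rewrite ?expr0 ?det1 // !exprS IHk -det_mulmx.
Qed.

Lemma frac_eq_quot (K : fieldType) (x : {fraction {poly K}}) :
  exists a b : {poly K}, b != 0 /\ x = FracField.tofrac a / FracField.tofrac b.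
Proof.
by exists (rf_num x), (rf_den x); split; [exact: rf_den_neq0 | exact: rf_numden].
Qed.

Lemma mupX (K : fieldType) (x : K) (u : {poly K}) n :
  u != 0 -> mup x (u ^+ n) = (n * mup x u)%N.
Proof.
move=> u0; elim: n => [|n IHn]; first by rewrite expr0 mupNroot // root1.
by rewrite exprS mupM ?expf_neq0 // IHn mulSn.
Qed.

(** Bezout's form of: [n] and the multiplicities of the roots of [H] have
    greatest common divisor 1.  Then [H] is not an [m]-th power for any
    [m > 1] dividing [n]. *)
Definition primitive_exponent (K : fieldType) (H : {poly K}) (n : nat) :=
  forall s : nat, (forall x, n %| s * mup x H)%N -> (n %| s)%N.

(** Irreducibility of [Y ^ n - c / H] over the field of rational functions.
    A factor of degree [s] has a norm [u] with [u ^ n = (c / H) ^ s];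
    comparing multiplicities at each point, [n] divides [s] times the
    multiplicity of [H], hence [n] divides [s]. *)
Lemma dvdp_Xn_sub_irreducible (K : fieldType) (H : {poly K}) (c : K) (n : nat)
    (p : {poly {fraction {poly K}}}) :
  (0 < n)%N -> H != 0 -> c != 0 -> primitive_exponent H n ->
  p %| 'X^n - (FracField.tofrac c%:P / FracField.tofrac H)%:P ->
  (1 < size p)%N -> (n < size p)%N.
Proof.
move=> n_gt0 H0 c0 nH /dvdp_Xn_sub_norm [u uE] sp.
set s := (size p).-1 in uE.
have ns : (n %| s)%N.
  apply: nH => x.
  have [a [b [b0 uab]]] := frac_eq_quot u.
  have cP0 : c%:P != 0 :> {poly K} by rewrite polyC_eq0.
  have E : H ^+ s * a ^+ n = c%:P ^+ s * b ^+ n.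
    apply/eqP; rewrite -tofrac_eq !tofracM !tofracXn; apply/eqP.
    move: uE; rewrite uab !expr_div_n => /eqP.
    rewrite eqr_div ?expf_neq0 ?tofrac_eq0 // => /eqP E.
    by rewrite mulrC E.
  have a0 : a != 0.
    apply: contraTneq (mulf_neq0 (expf_neq0 s cP0) (expf_neq0 n b0)) => a0.
    by rewrite -E a0 expr0n eqn0Ngt n_gt0 mulr0 eqxx.
  have := congr1 (mup x) E.
  rewrite !mupM ?expf_neq0 // !mupX // (@mupNroot _ x c%:P) ?rootC //.
  rewrite muln0 add0n => E1.
  have : (n %| s * mup x H + n * mup x a)%N by rewrite E1 dvdn_mulr.
  by rewrite dvdn_addl // dvdn_mulr.
have := dvdn_leq _ ns; rewrite /s; lia.
Qed.

Lemma pchar_powB (R : comNzRingType) (Q : nat) (x y : R) :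
  [pchar R].-nat Q -> (x - y) ^+ Q = x ^+ Q - y ^+ Q.
Proof.
move=> Qp; apply/eqP; rewrite -[_ == _](inj_eq (addIr (y ^+ Q))) subrK.
by rewrite -exprDn_pchar // subrK.
Qed.

Lemma pnat_pchar_poly (R : nzRingType) Q :
  [pchar R].-nat Q -> [pchar {poly R}].-nat Q.
Proof. by rewrite (eq_pnat _ (pchar_poly R)). Qed.

(** Independence of the powers of [Y = H ^ N].  Modulo [(X - b) ^ Q] this
    [Y] satisfies [H Y ^ n = H ^ Q = H(b) ^ Q = c], because [Q] is a power of
    the characteristic.  The resultant in [Y] of the relation and of
    [H Y ^ n - c] lies in the ideal that they generate, so it is divisible by
    [(X - b) ^ Q]; its degree being smaller than [Q], it is 0.  Thus the
    relation has a common factor with the irreducible [Y ^ n - c / H], which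
    its degree [< n] forbids. *)
Lemma power_relation_trivial (K : fieldType) (H : {poly K}) (b : K)
    (n N Q A : nat) (k : 'I_n -> {poly K}) :
  (0 < n)%N -> [pchar K].-nat Q -> (n * N).+1 = Q ->
  primitive_exponent H n -> H.[b] != 0 -> 
  (n * (A + (size H).-1) <= Q)%N -> (forall i, size (k i) <= A)%N ->
  ('X - b%:P) ^+ Q %| \sum_i k i * (H ^+ N) ^+ i ->
  forall i, k i = 0.
Proof.
move=> n_gt0 QK nN nH Hb sz ksz dvdk.
have H0 : H != 0 by apply: contraNneq Hb => ->; rewrite horner0.
pose c := H.[b] ^+ Q; have c0 : c != 0 by rewrite expf_neq0.
have dvdH : ('X - b%:P) ^+ Q %| H ^+ Q - c%:P.
  rewrite polyC_exp -pchar_powB ?pnat_pchar_poly //.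
  by apply: dvdp_exp2r; rewrite dvdp_XsubCl rootE !hornerE subrr.
pose B : {poly {poly K}} := \poly_(i < n) (if insub i is Some j then k j else 0).
have Bi (i : 'I_n) : B`_i = k i by rewrite coef_poly ltn_ord valK.
have [B0 i|B0] := eqVneq B 0; first by rewrite -Bi B0 coef0.
exfalso.
have BH : B.[H ^+ N] = \sum_i k i * (H ^+ N) ^+ i.
  rewrite (@horner_coef_wide _ n) ?size_poly //.
  by apply: eq_bigr => i _; rewrite Bi.
have A_gt0 : (0 < A)%N.
  rewrite lt0n; apply: contraNneq B0 => A0; apply/eqP/polyP=> i.
  rewrite coef0 coef_poly; case: ifP => // i_lt; rewrite insubT.
  by apply/size_poly_leq0P; rewrite -A0.
have szB : (size B <= n)%N := size_poly _ _.
pose T : {poly {poly K}} := H *: 'X^n - c%:P%:P.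
have sT : size T = n.+1.
  rewrite /T size_polyDl size_scale ?size_polyXn //.
  by rewrite size_polyN size_polyC; apply: leq_ltn_trans (leq_b1 _) _.
have T0 : T != 0 by rewrite -size_poly_eq0 sT.
have TH : ('X - b%:P) ^+ Q %| T.[H ^+ N].
  by rewrite !hornerE -exprM -exprS mulnC nN.
have dvd_small (r : {poly K}) : (size r <= Q)%N ->
  ('X - b%:P) ^+ Q %| r -> r = 0.
  move=> szr /dvdp_leq; case: eqP => // _ /(_ isT).
  by rewrite size_exp_XsubC leqNgt ltnS szr.
have [/size1_polyC BC|sB] := leqP (size B) 1.
  rewrite -BH BC hornerC in dvdk; move: B0; rewrite BC => /eqP; apply.
  rewrite (dvd_small B`_0) // coef_poly n_gt0 insubT.
  apply: leq_trans (ksz _) _; apply: leq_trans sz; nia.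
have sT1 : (1 < size T)%N by rewrite sT.
have [[u v] /= _ uvE] := resultant_in_ideal sB sT1.
have r0 : resultant B T = 0.
  apply: dvd_small; last first.
    have -> : resultant B T = (u * B + v * T).[H ^+ N] by rewrite -uvE hornerC.
    by rewrite hornerD !hornerM dvdp_add ?dvdp_mull ?BH.
  apply: (@leq_trans (\sum_(i < (size T).-1 + (size B).-1)
     match split i with inl _ => A.-1 | inr _ => (size H).-1 end).+1).
    apply: size_det_bound => i j; rewrite Sylvester_mxE.
    case: (split i) => l; case: (l <= j)%N; rewrite ?mulr0n ?size_poly0 //.
      rewrite mulr1n prednK // coef_poly; case: ifP => [lt_jn|]; rewrite ?size_poly0 //.
      by rewrite insubT.
    rewrite mulr1n coefB coefZ coefXn coefC prednK ?size_poly_gt0 //.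
    apply: leq_trans (size_polyD _ _) _; rewrite geq_max size_polyN.
    apply/andP; split; first by case: eqP; rewrite ?mulr1 // mulr0 size_poly0.
    case: eqP => _; rewrite ?size_poly0 // size_polyC.
    by apply: leq_trans (leq_b1 _) _; rewrite size_poly_gt0.
  (* the resultant is a determinant with [n] rows of coefficients of [B] and
     [size B - 1] rows of coefficients of [T] *)
  rewrite big_split_ord /=.
  under eq_bigr => i _ do rewrite (unsplitK (inl _ i)).
  under [X in (_ + X)%N]eq_bigr => i _ do rewrite (unsplitK (inr _ i)).
  rewrite !sum_nat_const !card_ord sT /=.
  apply: leq_trans sz; move: szB sB A_gt0 n_gt0.
  case: (A) => // a; case: (size B) => // l /=; nia.

have BL0 : map_poly (@tofrac {poly K}) B != 0.
  by rewrite map_poly_eq0_id0 // tofrac_eq0 lead_coef_eq0.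
have tofrac_lead (P : {poly {poly K}}) : P != 0 -> tofrac (lead_coef P) != 0.
  by move=> P0; rewrite tofrac_eq0 lead_coef_eq0.
have := congr1 (@tofrac {poly K}) r0; rewrite tofrac0 map_resultant ?tofrac_lead //.
move/eqP; rewrite resultant_eq0; set g := gcdp _ _ => g_gt1.
have gB : (size g <= n)%N.
  apply: leq_trans (dvdp_leq BL0 (dvdp_gcdl _ _)) _.
  by rewrite size_map_poly_id0 ?tofrac_lead.
have /dvdp_Xn_sub_irreducible : g %| 'X^n - (tofrac c%:P / tofrac H)%:P.
  have -> : 'X^n - (tofrac c%:P / tofrac H)%:P =
      (tofrac H)^-1 *: map_poly (@tofrac {poly K}) T.
    rewrite /T rmorphB /= map_polyZ map_polyXn map_polyC /= scalerBr scalerA.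
    by rewrite mulVf ?tofrac_eq0 // scale1r -mul_polyC -polyCM mulrC.
  by apply: dvdp_trans (dvdp_gcdr _ _) _; rewrite dvdpZr ?invr_eq0 ?tofrac_eq0.
by move=> /(_ n_gt0 H0 c0 nH g_gt1); rewrite ltnNge gB.
Qed.

(** * Stepanov's auxiliary polynomial *)

Lemma underdetermined_system (F : fieldType) (T1 T2 : finType)
    (c : T1 -> T2 -> F) :
  (#|T2| < #|T1|)%N ->
  exists2 v : T1 -> F, (exists t, v t != 0) &
    forall t2, \sum_t1 v t1 * c t1 t2 = 0.
Proof.
move=> lt21; pose A := \matrix_(i < #|T1|, j < #|T2|) c (enum_val i) (enum_val j).
have kA : kermx A != 0.
  rewrite -mxrank_eq0 mxrank_ker -lt0n subn_gt0.
  by apply: leq_ltn_trans (rank_leq_col _) lt21.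
have /rowV0Pn [u u_ker u0] := kA.
have /sub_kermxP uA : (u <= kermx A)%MS by [].
exists (fun t => u 0 (enum_rank t)).
  have /rV0Pn [i ui] := u0.
  by exists (enum_val i); rewrite enum_valK.
move=> t2; have := congr1 (fun B : 'rV_ _ => B 0 (enum_rank t2)) uA.
rewrite !mxE (reindex enum_rank) => [E|]; last first.
  by exists enum_val => i _; rewrite ?enum_rankK ?enum_valK.
by rewrite -[RHS]E; apply: eq_bigr => t _; rewrite mxE !enum_rankK.
Qed.

Section Substitution.

Variables (K : fieldType) (H : {poly K}).
Let m := (size H).-1.

(** The Taylor expansion of [p (X + H * T)] in the new variable [T].  With
    [H * T] in place of the usual increment, [p] vanishes to order [M] at a
    point where [H] does not vanish as soon as the first [M] coefficients do
    (as with derivatives, but in any characteristic), and [H (X + H T)] is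
    divisible by [H], so that high powers of [H] expand with coefficients of
    small degree. *)
Definition shiftp (p : {poly K}) : {poly {poly K}} :=
  map_poly polyC p \Po ('X%:P + H *: 'X).

Lemma shiftpD : {morph shiftp : u v / u + v}.
Proof. by move=> u v; rewrite /shiftp rmorphD /= comp_polyD. Qed.

Lemma shiftpM : {morph shiftp : u v / u * v}.
Proof. by move=> u v; rewrite /shiftp rmorphM /= comp_polyM. Qed.

Lemma shiftpC c : shiftp c%:P = c%:P%:P.
Proof. by rewrite /shiftp map_polyC /= comp_polyC. Qed.

Lemma shiftpX : shiftp 'X = 'X%:P + H *: 'X.
Proof. by rewrite /shiftp map_polyX comp_polyX. Qed.

Lemma shiftpXn u n : shiftp (u ^+ n) = shiftp u ^+ n.
Proof.
elim: n => [|n IHn]; first by rewrite !expr0 shiftpC.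
by rewrite !exprS shiftpM IHn.
Qed.

Lemma shiftp_sum (I : Type) (r : seq I) (F : I -> {poly K}) :
  shiftp (\sum_(i <- r) F i) = \sum_(i <- r) shiftp (F i).
Proof. by apply: (big_morph _ shiftpD); rewrite shiftpC. Qed.

Lemma shiftp_congr p : exists R, shiftp p = p%:P + H *: R.
Proof.
elim/poly_ind: p => [|p c [R E]].
  by exists 0; rewrite shiftpC scaler0 addr0.
exists (p%:P * 'X + R * ('X%:P + H *: 'X)).
rewrite shiftpD shiftpM shiftpC shiftpX E -!mul_polyC polyCD polyCM; ring.
Qed.

(** The degree in [X] of the coefficient of [T ^ l] grows by at most
    [deg H] with each [l]. *)
Definition slope_bound (A : nat) (P : {poly {poly K}}) :=
  forall l, (size (P`_l)%R <= (A + l * m).+1)%N.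

Lemma slope_boundM A B P R :
  slope_bound A P -> slope_bound B R -> slope_bound (A + B) (P * R).
Proof.
move=> PA RB l; rewrite coefM; apply: size_sum_bound => i _.
have := size_mul_bound (PA i) (RB (l - i)%N).
by move/leq_trans; apply; have := ltn_ord i; nia.
Qed.

Lemma slope_boundX A P n : slope_bound A P -> slope_bound (n * A) (P ^+ n).
Proof.
move=> PA; elim: n => [|n IHn] => [l|]; last by rewrite exprS mulSn; apply: slope_boundM.
by rewrite expr0 coefC; case: eqP => _; rewrite ?size_poly1 ?size_poly0.
Qed.

Lemma slope_bound_shiftX : slope_bound 1 (shiftp 'X).
Proof.
move=> l; rewrite shiftpX coefD coefC coefZ coefX.
case: l => [|[|l]] /=; first by rewrite mulr0 addr0 size_polyX.
  by rewrite add0r mulr1 mul1n; apply: leq_trans (leqSpred _) (leqnSn _).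
by rewrite mulr0 addr0 size_poly0.
Qed.

Lemma slope_bound_shift A (p : {poly K}) : (size p <= A.+1)%N -> slope_bound A (shiftp p).
Proof.
move=> pA l; rewrite -[p]coefK poly_def shiftp_sum coef_sum.
apply: size_sum_bound => i _.
rewrite -mul_polyC shiftpM shiftpXn shiftpC coefCM mul_polyC.
apply: leq_trans (size_scale_leq _ _) _.
apply: leq_trans (slope_boundX _ slope_bound_shiftX _) _.
by have := leq_trans (ltn_ord i) pA; lia.
Qed.

Lemma shiftp_cofactor : H != 0 ->
  exists2 U, shiftp H = H *: U & slope_bound 0 U.
Proof.
move=> H0; have [R RE] := shiftp_congr H.
exists (1 + R); first by rewrite scalerDr alg_polyC RE.
move=> l; have := slope_bound_shift (leqSpred (size H)) l.
have -> : shiftp H = H *: (1 + R) by rewrite scalerDr alg_polyC RE.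
have [->|U0] := eqVneq (1 + R)`_l 0; first by rewrite size_poly0.
rewrite coefZ size_mul // /m; move: H0; rewrite -size_poly_gt0.
by move: (size _) (size _) => a b; lia.
Qed.

Definition eval_coefs (a : K) : {poly {poly K}} -> {poly K} :=
  map_poly (horner_eval a).

Lemma eval_shift a p : eval_coefs a (shiftp p) = p \Po (a%:P + H.[a] *: 'X).
Proof.
have evC : map_poly (horner_eval a) (map_poly polyC p) = p.
  by apply/polyP=> i; rewrite !coef_map /= /horner_eval hornerC.
rewrite /eval_coefs /shiftp map_comp_poly evC rmorphD /=.
by rewrite map_polyC map_polyZ map_polyX /= /horner_eval hornerX.
Qed.

Lemma dvdp_of_shift a M r : H.[a] != 0 ->
  'X^M %| eval_coefs a (shiftp r) -> ('X - a%:P) ^+ M %| r.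
Proof.
rewrite eval_shift => Ha /dvdpP [u uE].
have : r = (r \Po (a%:P + H.[a] *: 'X)) \Po (H.[a]^-1 *: ('X - a%:P)).
  rewrite -comp_polyA comp_polyD comp_polyC comp_polyZ comp_polyX scalerA.
  by rewrite mulfV // scale1r addrC subrK comp_polyXr.
rewrite uE comp_polyM => ->; apply: dvdp_mull.
by rewrite comp_Xn_poly exprZn dvdpZr ?expf_neq0 ?invr_eq0.
Qed.

End Substitution.

Lemma dvdp_prod_XsubC_exp (K : fieldType) (s : seq K) (M : nat) (r : {poly K}) :
  uniq s -> {in s, forall a, ('X - a%:P) ^+ M %| r} ->
  \prod_(a <- s) ('X - a%:P) ^+ M %| r.
Proof.
elim: s => [|a s IHs]; first by rewrite big_nil dvd1p.
rewrite /= big_cons => /andP [a_s us] rs.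
rewrite Gauss_dvdp.
  by rewrite rs ?mem_head // IHs // => x xs; rewrite rs // inE xs orbT.
rewrite big_seq; elim/big_rec: _ => [|b u bs co_au]; first exact: coprimep1.
rewrite coprimepMr co_au andbT coprimep_expl ?coprimep_expr //.
by rewrite coprimep_XsubC2 // subr_eq0; apply: contraNneq a_s => <-.
Qed.

Lemma dvdp_sum (K : fieldType) (I : Type) (s : seq I) (u : {poly K})
    (F : I -> {poly K}) :
  (forall i, u %| F i) -> u %| \sum_(i <- s) F i.
Proof.
by move=> uF; elim/big_ind: _ => [|v w|//]; [apply: dvdp0 | apply: dvdp_add].
Qed.

(** Uniqueness of digits in base [Z]: the digits are removed one at a time,
    starting from the lowest, which is divisible by [Z]. *)
Lemma zero_digits (R : idomainType) (Z : {poly R}) (K : nat) (B : 'I_K -> {poly R}) :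
  Z != 0 -> (forall j, Z %| B j -> B j = 0) ->
  \sum_j B j * Z ^+ j = 0 -> forall j, B j = 0.
Proof.
move=> Z0; elim: K B => [|K IHK] B BZ; first by move=> _ [].
rewrite big_ord_recl expr0 mulr1.
have -> : \sum_(i < K) B (lift ord0 i) * Z ^+ lift ord0 i =
    (\sum_(i < K) B (lift ord0 i) * Z ^+ i) * Z.
  by rewrite mulr_suml; apply: eq_bigr => i _; rewrite lift0 exprSr mulrA.
move=> E; have B0 : B ord0 = 0.
  apply: BZ; have /eqP := E; rewrite addr_eq0 => /eqP ->.
  by rewrite -mulNr dvdp_mull.
move: E; rewrite B0 add0r => /eqP; rewrite mulf_eq0 (negPf Z0) orbF => /eqP E.
move=> j; case: (unliftP ord0 j) => [i ->|-> //].
by apply: (IHK (fun i => B (lift ord0 i))) => // i0; apply: BZ.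
Qed.

Section Auxiliary.

Variables (K : fieldType) (H : {poly K}) (b : K) (n N Q : nat).
Let m := (size H).-1.

Hypotheses (n_gt0 : (0 < n)%N) (QK : [pchar K].-nat Q) (nN : (n * N).+1 = Q).
Hypotheses (nH : primitive_exponent H n) (Hb : H.[b] != 0).

Variables (A D : nat) (k : 'I_n -> 'I_D -> {poly K}).
Hypothesis k_size : forall i j, (size (k i j) <= A)%N.

(** On the points [a] with [a ^ Q = a] and [H(a) ^ N = z] the factor [H ^ N]
    is the constant [z] and [(X - b) ^ Q] is the linear polynomial
    [X - b ^ Q]: there a polynomial of very large degree is cheap to
    control.  [aux_jet] is its Taylor expansion after these replacements. *)
Definition aux_poly : {poly K} :=
  \sum_j (\sum_i k i j * (H ^+ N) ^+ i) * (('X - b%:P) ^+ Q) ^+ j.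

Lemma aux_poly_neq0 :
  (n * (A + m) <= Q)%N -> aux_poly = 0 -> forall i j, k i j = 0.
Proof.
move=> sz aux0 i j.
have div_small j' : ('X - b%:P) ^+ Q %| \sum_i k i j' * (H ^+ N) ^+ i ->
    forall i, k i j' = 0 by exact: (@power_relation_trivial _ _ b n N Q A).
have Z0 : ('X - b%:P) ^+ Q != 0 by rewrite expf_neq0 // polyXsubC_eq0.
have digit0 : forall j', \sum_i k i j' * (H ^+ N) ^+ i = 0.
  apply: zero_digits Z0 _ aux0 => j' /div_small k0.
  by rewrite big1 // => i' _; rewrite k0 mul0r.
by apply: div_small; rewrite digit0 dvdp0.
Qed.

Lemma size_aux_poly : (0 < A)%N -> (size aux_poly <= A + Q * (m + D))%N.
Proof.
move=> A_gt0; apply: size_sum_bound => j _.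
have sZ : (size ((('X - b%:P) ^+ Q) ^+ j)%R <= (Q * j).+1)%N.
  by rewrite -exprM size_exp_XsubC.
have sB : (size (\sum_i k i j * (H ^+ N) ^+ i)%R <= (A.-1 + Q * m).+1)%N.
  apply: size_sum_bound => i _.
  apply: leq_trans (@size_mul_bound _ _ _ A.-1 (m * (N * i)) _ _) _.
  - by rewrite prednK.
  - by rewrite -exprM size_poly_exp_leq.
  rewrite ltnS leq_add2l mulnC leq_mul2r -nN ltnW ?orbT // ltnS mulnC.
  by rewrite leq_mul2r ltnW ?orbT.
apply: leq_trans (size_mul_bound sB sZ) _.
rewrite -2!addSn prednK // -addnA -mulnDr leq_add2l leq_mul2l leq_add2l.
by rewrite ltnW ?orbT.
Qed.

Variables (U : {poly {poly K}}) (HU : shiftp H H = H *: U).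

Definition aux_jet (z : K) : {poly {poly K}} :=
  \sum_j \sum_i shiftp H (k i j) * U ^+ (N * i) *
     ((z ^+ i)%:P * ('X - (b ^+ Q)%:P) ^+ j)%:P.

(** [(X + H T) - b] raised to the [Q] has no terms in [T] below [T ^ Q], so
    replacing it by its value at [T = 0] does not affect the first [M <= Q]
    coefficients. *)
Lemma aux_poly_vanishes (M : nat) (a z : K) : (M <= Q)%N ->
  (forall l, (l < M)%N -> (aux_jet z)`_l = 0) ->
  a ^+ Q = a -> H.[a] != 0 -> H.[a] ^+ N = z ->
  ('X - a%:P) ^+ M %| aux_poly.
Proof.
move=> MQ jet0 aQ Ha Hz; apply: (dvdp_of_shift Ha).
have ev_jet : 'X^M %| eval_coefs a (aux_jet z).
  have -> : aux_jet z = drop_poly M (aux_jet z) * 'X^M.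
    rewrite -[LHS](poly_take_drop M) [take_poly _ _](_ : _ = 0) ?add0r //.
    apply/polyP=> l; rewrite coef_take_poly coef0.
    by case: ifP => // /jet0.
  by rewrite /eval_coefs rmorphM /= map_polyXn dvdp_mull.
rewrite -(dvdp_subl _ ev_jet) -rmorphB /=.
rewrite /aux_poly /aux_jet shiftp_sum -sumrB rmorph_sum /=.
pose W j := \sum_i eval_coefs a (shiftp H (k i j)) * eval_coefs a U ^+ (N * i)
  * (z ^+ i)%:P.
pose Z := eval_coefs a (shiftp H (('X - b%:P) ^+ Q)).
have evZ : 'X^M %| Z - (a - b ^+ Q)%:P.
  have -> : Z - (a - b ^+ Q)%:P = H.[a] ^+ Q *: 'X^Q.
    rewrite /Z shiftpXn /eval_coefs rmorphXn /= -/(eval_coefs _ _) eval_shift.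
    rewrite comp_polyB comp_polyX comp_polyC addrAC -polyCB.
    rewrite exprDn_pchar ?pnat_pchar_poly // -polyC_exp pchar_powB // aQ.
    by rewrite exprZn addrC addKr.
  by rewrite dvdpZr ?expf_neq0 // dvdp_exp2l.
have ev_aux j : eval_coefs a (shiftp H ((\sum_i k i j * (H ^+ N) ^+ i) *
    (('X - b%:P) ^+ Q) ^+ j)) = W j * Z ^+ j.
  rewrite shiftpM shiftpXn /eval_coefs rmorphM rmorphXn /=; congr (_ * _).
  rewrite shiftp_sum rmorph_sum; apply: eq_bigr => i _ /=.
  rewrite shiftpM !shiftpXn HU rmorphM /= -mulrA; congr (_ * _).
  rewrite -exprM !rmorphXn /= map_polyZ /= exprZn -mul_polyC mulrC.
  by congr (_ * _); rewrite -Hz !polyC_exp -exprM.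
have ev_jetj j : eval_coefs a (\sum_i shiftp H (k i j) * U ^+ (N * i) *
     ((z ^+ i)%:P * ('X - (b ^+ Q)%:P) ^+ j)%:P) = W j * (a - b ^+ Q)%:P ^+ j.
  rewrite /eval_coefs rmorph_sum mulr_suml; apply: eq_bigr => i _ /=.
  rewrite !rmorphM /= rmorphXn /= map_polyC /= -mulrA -[RHS]mulrA -[in RHS]mulrA.
  congr (_ * (_ * _)).
  by rewrite map_polyC /= /horner_eval !hornerE !polyC_exp.
apply: dvdp_sum => j.
rewrite rmorphB /= -!/(eval_coefs a _) ev_aux ev_jetj.
by rewrite -mulrBr subrXX; apply: dvdp_mull; apply: dvdp_mulr.
Qed.

End Auxiliary.

Lemma size_aux_jet (K : fieldType) (H : {poly K}) (b : K) n N Q A D M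
    (k : 'I_n -> 'I_D -> {poly K}) (U : {poly {poly K}}) (z : K) l :
  (forall i j, (size (k i j) <= A)%N) -> (0 < A)%N -> slope_bound H 0 U ->
  (l < M)%N ->
  (size ((aux_jet H b N Q k U z)`_l)%R <= A + M * (size H).-1 + D)%N.
Proof.
move=> kA A_gt0 U0 lM; rewrite coef_sum; apply: size_sum_bound => j _.
rewrite coef_sum; apply: size_sum_bound => i _; rewrite coefMC.
have sk : slope_bound H A.-1 (shiftp H (k i j) * U ^+ (N * i)).
  rewrite -[A.-1]addn0 -[X in (_ + X)%N](muln0 (N * i)).
  apply: slope_boundM; last exact: slope_boundX.
  by apply: slope_bound_shift; rewrite prednK.
apply: leq_trans (@size_mul_bound _ _ _ _ j (sk l) _) _.
  rewrite mul_polyC; apply: leq_trans (size_scale_leq _ _) _.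
  by rewrite size_exp_XsubC.
have := ltn_ord j; nia.
Qed.

(** The number of unknown coefficients is [n * D * A] and the number of
    linear conditions [w * (A + w * m + D)].  [A] is chosen as large as
    independence of the powers permits, about [w ^ 2 / n - m]; then [D]
    barely larger than [w / n] suffices, and the excess [n * D - w] is what
    the final bound loses. *)
Lemma stepanov_parameters (n m w : nat) :
  (0 < n)%N -> (n * (2 * m + 6) * m.+1 <= w)%N ->
  exists A D, [/\ (0 < A)%N, (n * (A + m) <= w * w)%N,
    (w * (A + w * m + D) < n * D * A)%N & (n * D <= w + n * (2 * m + 6))%N].
Proof.
move=> n_gt0 w_big.
have w_gt0 : (0 < w)%N by nia.
have nm_w : (n * m.+1 <= w)%N by nia.
have nm_w5 : ((2 * m + 5) * (n * m.+1) <= w)%N by nia.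
have w_Q : (w <= w * w)%N by rewrite leq_pmulr.
have m_w : (2 * m + 6 <= w)%N by nia.
have mQ : (m <= (w * w) %/ n)%N by rewrite leq_divRL //; nia.
have A_hi : (n * ((w * w) %/ n) <= w * w)%N by rewrite mulnC leq_trunc_div.
have A_lo : (w * w < n * ((w * w) %/ n).+1)%N by rewrite mulnC ltn_ceil.
have D_hi : (n * (w %/ n) <= w)%N by rewrite mulnC leq_trunc_div.
have D_lo : (w < n * (w %/ n).+1)%N by rewrite mulnC ltn_ceil.
have D_w : (w %/ n <= w)%N by rewrite leq_div.
move: mQ A_hi A_lo D_hi D_lo D_w.
set B := ((w * w) %/ n)%N; set E := (w %/ n)%N; clearbody B E.
move=> mB B_hi B_lo E_hi E_lo E_w.
have B_gt : (m < B)%N by nia.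
exists (B - m)%N, (E + (2 * m + 6))%N; rewrite subn_gt0 subnK ?(ltnW B_gt) //.
split=> //; last by rewrite mulnDr leq_add2r.
have BA : B = (B - m + m)%N by rewrite subnK // ltnW.
move: (B - m)%N BA => A BA; rewrite {}BA {B mB B_hi B_gt} in B_lo *.
have E1 : (w * (A + w * m + (E + (2 * m + 6))) <= w * A + (m + 2) * (w * w))%N by nia.
have E2 : (w * A + n * (2 * m + 5) * A <= n * (E + (2 * m + 6)) * A)%N.
  by rewrite -mulnDl leq_mul2r; apply/orP; right; nia.
have E3 : ((2 * m + 5) * (w * w) <=
    n * (2 * m + 5) * A + (2 * m + 5) * (n * m.+1))%N.
  have : ((2 * m + 5) * (w * w) <= (2 * m + 5) * (n * (A + m).+1))%N.
    by rewrite leq_mul2l ltnW ?orbT.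
  by move/leq_trans; apply; nia.
have Q_gt0 : (0 < w * w)%N by rewrite muln_gt0 w_gt0.
move: (w * w)%N E1 E2 E3 Q_gt0 w_Q => Q E1 E2 E3 Q_gt0 w_Q.
apply: leq_ltn_trans E1 _; apply: leq_trans E2; rewrite ltn_add2l.
rewrite -(ltn_add2r ((2 * m + 5) * (n * m.+1))); apply: leq_trans E3.
apply: leq_ltn_trans (_ : (m + 2) * Q + Q < _)%N; last by nia.
by rewrite leq_add2l (leq_trans nm_w5).
Qed.

(** Linear algebra yields a nonzero combination whose expansion vanishes to
    order [w] at all points of [S]; comparing [w * size S] with its degree,
    about [w ^ 2 * w / n], gives the bound. *)
Theorem stepanov_bound (K : fieldType) (H : {poly K}) (b z : K)
    (n N w : nat) (S : seq K) (m := (size H).-1) :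
  (0 < n)%N -> [pchar K].-nat w -> (n * N).+1 = (w * w)%N ->
  (n * (2 * m + 6) * m.+1 <= w)%N ->
  primitive_exponent H n -> H.[b] != 0 -> uniq S ->
  {in S, forall a, [/\ a ^+ (w * w) = a, H.[a] != 0 & H.[a] ^+ N = z]} ->
  (n * size S <= w * w + n * (3 * m + 7) * w)%N.
Proof.
move=> n_gt0 wK nN w_big nH Hb uS SP; pose Q := (w * w)%N.
have w_gt0 : (0 < w)%N by nia.
have QK : [pchar K].-nat Q by rewrite pnatM wK.
have H0 : H != 0 by apply: contraNneq Hb => ->; rewrite horner0.
have [U HU U0] := shiftp_cofactor H0.
have [A [D [A_gt0 A_hi room D_hi]]] := stepanov_parameters n_gt0 w_big.
have many : (#|{: 'I_w * 'I_(A + w * m + D)}| < #|{: 'I_n * 'I_D * 'I_A}|)%N.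
  by rewrite !card_prod !card_ord.
(* the unknowns are the coefficients of the [k i j] *)
pose mono (t : 'I_n * 'I_D * 'I_A) (i : 'I_n) (j : 'I_D) : {poly K} :=
  if t.1 == (i, j) then 'X^(t.2) else 0.
have [v [t0 vt0] vP] := underdetermined_system
  (fun t (u : 'I_w * 'I_(A + w * m + D)) =>
     (aux_jet H b N Q (mono t) U z)`_(u.1)`_(u.2)) many.
pose k i j : {poly K} := \sum_t v t *: mono t i j.
have kA i j : (size (k i j) <= A)%N.
  apply: size_sum_bound => t _; apply: leq_trans (size_scale_leq _ _) _.
  by rewrite /mono; case: ifP => _; rewrite ?size_poly0 // size_polyXn.
have jetE : aux_jet H b N Q k U z = \sum_t (v t)%:P *: aux_jet H b N Q (mono t) U z.
  under [RHS]eq_bigr => t _ do rewrite scaler_sumr.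
  rewrite exchange_big; apply: eq_bigr => j _ /=.
  under [RHS]eq_bigr => t _ do rewrite scaler_sumr.
  rewrite exchange_big; apply: eq_bigr => i _ /=.
  rewrite shiftp_sum !mulr_suml; apply: eq_bigr => t _.
  by rewrite -mul_polyC shiftpM shiftpC -!mul_polyC !mulrA.
have jet0 l : (l < w)%N -> (aux_jet H b N Q k U z)`_l = 0.
  move=> lw; apply/polyP=> s; rewrite coef0.
  have [s_lt|s_ge] := ltnP s (A + w * m + D); last first.
    by rewrite nth_default // (leq_trans _ s_ge) // size_aux_jet.
  rewrite jetE coef_sum coef_sum -[RHS](vP (Ordinal lw, Ordinal s_lt)).
  by apply: eq_bigr => t _; rewrite coefZ coefCM.
pose r := aux_poly H b N Q k.
have r0 : r != 0.
  apply/eqP => r0; have := vt0.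
  have := congr1 (fun u : {poly K} => u`_(t0.2))
    (aux_poly_neq0 n_gt0 QK nN nH Hb kA A_hi r0 t0.1.1 t0.1.2).
  rewrite coef0 coef_sum (bigD1 t0) //= big1 ?addr0 => [|t].
    rewrite coefZ /mono -surjective_pairing eqxx coefXn eqxx.
    by rewrite mulr1 => ->; rewrite eqxx.
  rewrite coefZ /mono -surjective_pairing.
  case: (t.1 =P t0.1) => [t1|_] tt; last by rewrite coef0 mulr0.
  rewrite coefXn; case: eqP => [/val_inj t2|_]; last by rewrite mulr0.
  by case/eqP: tt; rewrite [t]surjective_pairing t1 -t2 -surjective_pairing.
have w_Q : (w <= Q)%N by rewrite leq_pmulr.
have rS : \prod_(a <- S) ('X - a%:P) ^+ w %| r.
  apply: dvdp_prod_XsubC_exp => // a /SP [aQ Ha Hz].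
  exact: (aux_poly_vanishes QK HU w_Q jet0 aQ Ha Hz).
have := leq_trans (dvdp_leq r0 rS) (size_aux_poly H b nN kA A_gt0).
rewrite prodrXl; set p := \prod_(a <- S) _.
have sp : size p = (size S).+1 by rewrite size_prod_XsubC.
have p0 : p != 0 by rewrite -size_poly_eq0 sp.
have -> : size (p ^+ w) = (size S * w).+1.
  by rewrite -[LHS]prednK ?size_exp ?sp // size_poly_gt0 expf_neq0.
move=> le1; have A_w2 : (A <= Q)%N.
  apply: leq_trans A_hi; apply: leq_trans (leq_addr m A) _.
  by rewrite leq_pmull.
have : (size S * w <= (w * (1 + m + D)) * w)%N.
  rewrite mulnAC -/Q (leq_trans (leqnSn _)) // (leq_trans le1) //.
  by rewrite -addnA [X in (_ <= X)%N]mulnDr muln1 leq_add2r.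
rewrite leq_pmul2r // => le2.
apply: (@leq_trans (n * (w * (1 + m + D)))); first by rewrite leq_pmul2l.
rewrite mulnCA -mulnDl [X in (_ <= X)%N]mulnC leq_pmul2l // mulnDr.
apply: leq_trans (leq_add (leqnn _) D_hi) _; rewrite addnCA leq_add2l -mulnDr.
by rewrite leq_mul2l; apply/orP; right; lia.
Qed.

(** * Character sums over large fields *)

Lemma pchar_natr0 (R : nzRingType) Q : (1 < Q)%N -> [pchar R].-nat Q -> Q%:R = 0 :> R.
Proof.
move=> Q1 QR; have pQ := pdiv_prime Q1.
have pR : pdiv Q \in [pchar R].
  by apply: (pnatPpi QR); rewrite mem_primes pQ pdiv_dvd ltnW.
by rewrite -(divnK (pdiv_dvd Q)) natrM (pcharf0 pR) mulr0.
Qed.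

Section Frobenius.

Variables (F : comNzRingType) (Q : nat) (QF : [pchar F].-nat Q).

(** The hypothesis is an argument of the map, for the ring morphism structure
    to be found from the map alone. *)
Definition frob (_ : [pchar F].-nat Q) (x : F) : F := x ^+ Q.

Lemma frob_is_zmod_morphism : zmod_morphism (frob QF).
Proof. by move=> x y; rewrite /frob pchar_powB. Qed.

Lemma frob_is_monoid_morphism : monoid_morphism (frob QF).
Proof. by split=> [|x y]; rewrite /frob ?expr1n ?exprMn. Qed.

HB.instance Definition _ := GRing.isZmodMorphism.Build F F (frob QF)
  frob_is_zmod_morphism.
HB.instance Definition _ := GRing.isMonoidMorphism.Build F F (frob QF)
  frob_is_monoid_morphism.

End Frobenius.

Section FixedPoints.

Variable F : closedFieldType.

Definition frob_fixed (Q : nat) : seq F :=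
  undup (sval (closed_field_poly_normal ('X^Q - 'X : {poly F}))).

Lemma frob_fixed_uniq Q : uniq (frob_fixed Q).
Proof. exact: undup_uniq. Qed.

Lemma lead_coef_XnsubX Q : (1 < Q)%N ->
  (size ('X^Q - 'X : {poly F}) = Q.+1) * (lead_coef ('X^Q - 'X : {poly F}) = 1).
Proof.
move=> Q1; have sX : (size (- 'X : {poly F}) < size ('X^Q : {poly F}))%N.
  by rewrite size_polyN size_polyX size_polyXn.
by rewrite size_polyDl // size_polyXn lead_coefDl // lead_coefXn.
Qed.

Lemma mem_frob_fixed Q x : (1 < Q)%N -> (x \in frob_fixed Q) = (x ^+ Q == x).
Proof.
move=> Q1; rewrite mem_undup; case: closed_field_poly_normal => s /= sE.
move: sE; rewrite lead_coef_XnsubX // scale1r -root_prod_XsubC => <-.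
by rewrite rootE !hornerE subr_eq0.
Qed.

Lemma size_frob_fixed Q : (1 < Q)%N -> [pchar F].-nat Q ->
  size (frob_fixed Q) = Q.
Proof.
move=> Q1 QF; have [sz lc] := lead_coef_XnsubX Q1.
rewrite /frob_fixed; case: closed_field_poly_normal => s /= sE.
rewrite lc scale1r in sE; rewrite undup_id.
  by apply: succn_inj; rewrite -(size_prod_XsubC _ id) -sE sz.
rewrite -separable_prod_XsubC -sE separable_poly.unlock derivB derivXn derivX.
rewrite -mulr_natr (pchar_natr0 Q1 (pnat_pchar_poly QF)) mulr0 sub0r.
by rewrite -[X in coprimep _ X]scaleN1r coprimepZr ?oppr_eq0 ?oner_eq0 // coprimep1.
Qed.
End FixedPoints.

Lemma comp_polyXn_neq0 (F : fieldType) (u : {poly F}) n :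
  (0 < n)%N -> u != 0 -> u \Po 'X^n != 0.
Proof. by move=> n_gt0 u0; rewrite comp_poly_eq0 // size_polyXn ltnS. Qed.

Lemma horner_frob (F : comNzRingType) Q (QF : [pchar F].-nat Q) (u : {poly F}) x :
  u.[x] ^+ Q = (map_poly (frob QF) u).[x ^+ Q].
Proof. by rewrite -[LHS]/(frob QF u.[x]) -horner_map. Qed.

Lemma closed_field_poly_power (F : closedFieldType) (G : {poly F}) (k : nat) :
  (0 < k)%N -> G != 0 -> (forall x, k %| mup x G)%N -> exists H, H ^+ k = G.
Proof.
move=> k_gt0 G0 kG; have [s sE] := closed_field_poly_normal G.
have lG : lead_coef G != 0 by rewrite lead_coef_eq0.
have count_s x : mup x G = count_mem x s.
  rewrite sE -mul_polyC mupMr ?mu_prod_XsubC //.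
  by rewrite rootC.
have [y yE] : exists y, y ^+ k = lead_coef G.
  have /closed_rootP [y] : size ('X^k - (lead_coef G)%:P) != 1%N.
    by rewrite size_XnsubC // eqSS -lt0n.
  by rewrite rootE !hornerE subr_eq0 => /eqP; exists y.
exists (y *: \prod_(x <- undup s) ('X - x%:P) ^+ (count_mem x s %/ k)).
rewrite exprZn yE -prodrXl [RHS]sE; congr (_ *: _).
rewrite -[RHS]big_undup_iterop_count /=.
by apply: eq_bigr => x _; rewrite -exprM divnK -?count_s.
Qed.

Lemma dvdn_biggcd (I : Type) (r : seq I) (f : I -> nat) (e s : nat) :
  (forall i, e %| s * f i)%N ->
  (e %| s * \big[gcdn/e]_(i <- r) f i)%N.
Proof.
move=> sf; elim/big_ind: _ => [|a b ea eb|//]; first exact: dvdn_mull.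
by rewrite muln_gcdr dvdn_gcd ea.
Qed.

(** [k] is the greatest common divisor of [e] and of all multiplicities of
    roots; it differs from [e] because of the root [x0]. *)
Lemma closed_field_primitive_power (F : closedFieldType) (G : {poly F})
    (e : nat) (x0 : F) :
  (0 < e)%N -> G != 0 -> ~~ (e %| mup x0 G)%N ->
  exists k n H, [/\ (k * n = e)%N, (0 < k)%N, (1 < n)%N, H ^+ k = G &
     primitive_exponent H n].
Proof.
move=> e_gt0 G0 ex0; have [s sE] := closed_field_poly_normal G.
pose k := (\big[gcdn/e]_(x <- s) mup x G)%N.
have ke : (k %| e)%N.
  rewrite /k; elim: (s) => [|a r IH]; first by rewrite big_nil.
  by rewrite big_cons (dvdn_trans (dvdn_gcdr _ _)).
have kG x : (k %| mup x G)%N.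
  have [xs|xs] := boolP (x \in s).
    rewrite /k; elim: (s) xs => // y r IH; rewrite inE big_cons.
    case/predU1P=> [<-|/IH]; first exact: dvdn_gcdl.
    by apply: dvdn_trans; apply: dvdn_gcdr.
  rewrite mupNroot ?dvdn0 // sE rootZ ?lead_coef_eq0 //.
  by rewrite root_prod_XsubC.
have k_gt0 : (0 < k)%N := dvdn_gt0 e_gt0 ke.
have [H HE] := closed_field_poly_power k_gt0 G0 kG.
have H0 : H != 0 by apply: contraNneq G0 => H0; rewrite -HE H0 expr0n gtn_eqF.
exists k, (e %/ k)%N, H; split=> //; first by rewrite mulnC divnK.
  rewrite ltn_neqAle divn_gt0 // (dvdn_leq e_gt0 ke) andbT.
  by apply: contraNneq ex0 => ek; rewrite -(divnK ke) -ek mul1n.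
move=> t tH; rewrite -(dvdn_pmul2r k_gt0) divnK //.
apply: dvdn_biggcd => x; rewrite -HE mupX // mulnCA mulnC.
by rewrite -{1}(divnK ke) dvdn_pmul2r // mulnC.
Qed.

Lemma norm_prim_root (C : numClosedFieldType) (e : nat) (xi : C) :
  e.-primitive_root xi -> `|xi| = 1.
Proof.
move=> xiP; have e_gt0 := prim_order_gt0 xiP.
apply/eqP; rewrite -(pexpr_eq1 e_gt0) ?normr_ge0 // -normrX.
by rewrite (prim_expr_order xiP) normr1.
Qed.

Lemma sum_primitive_root_power (C : fieldType) (e k n : nat) (xi : C) :
  e.-primitive_root xi -> (k * n)%N = e -> (1 < n)%N ->
  \sum_(j < n) xi ^+ (k * j) = 0.
Proof.
move=> xiP kn n_gt1; pose y := xi ^+ k.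
have e_gt0 := prim_order_gt0 xiP.
have y1 : y != 1.
  rewrite -(prim_order_dvd xiP) -kn -{2}[k]muln1 dvdn_pmul2l ?dvdn1; last first.
    by case: (k) kn e_gt0 => // <-.
  by rewrite neq_ltn n_gt1 orbT.
apply: (mulfI (x := y - 1)); first by rewrite subr_eq0.
under eq_bigr => j _ do rewrite exprM.
by rewrite mulr0 -subrX1 -exprM kn (prim_expr_order xiP) subrr.
Qed.

(** Only upper bounds are needed to estimate the sum.  If [t_j] points have the
    [j]-th of the [n] possible values and [n t_j <= B] with
    [B = w ^ 2 + O(w)], then
    [n * sum = - sum of xi ^ j * (B - n t_j)], because the sum of the
    values [xi ^ j] is 0; the coefficients on the right are nonnegative and
    add up to [O(w)] since almost all points are counted by some [t_j].

    The values of [G ^ N0] lie in one coset of the group of [n]-th roots of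
    unity, which need not be the group itself: the coefficients of [H] may lie
    outside the field with [w ^ 2] elements. *)
Lemma large_sum_bound (F : closedFieldType) (C : numClosedFieldType)
    (G : {poly F}) (e : nat) (theta : F) (xi : C) (x0 : F) :
  G != 0 -> ~~ (e %| mup x0 G)%N ->
  e.-primitive_root theta -> e.-primitive_root xi ->
  exists C0 : nat, forall (w N0 : nat) (val : F -> C),
    (C0 <= w)%N -> (1 < w)%N -> [pchar F].-nat w -> (e * N0).+1 = (w * w)%N ->
    (forall i, G`_i ^+ (w * w) = G`_i) ->
    (forall x, x ^+ (w * w) = x -> G.[x] = 0 -> val x = 0) ->
    (forall x, x ^+ (w * w) = x -> G.[x] != 0 ->
       exists2 k, G.[x] ^+ N0 = theta ^+ k & val x = xi ^+ k) ->
  `| \sum_(x <- frob_fixed F (w * w)) val x | <= (C0 * w)%:R.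
Proof.
move=> G0 ex0 thetaP xiP; have e_gt0 := prim_order_gt0 thetaP.
have [k [n [H [kn k_gt0 n_gt1 HG nH]]]] := closed_field_primitive_power e_gt0 G0 ex0.
have n_gt0 := ltnW n_gt1.
pose m := (size H).-1.
pose C1 := (n * (3 * m + 7))%N.
exists (n * (2 * m + 6) * m.+1 + C1 + size G)%N.
move=> w N0 val w_big w_gt1 wF eN0 GQ val0 valP.
have {w_big} w_big : (n * (2 * m + 6) * m.+1 <= w)%N.
  by apply: leq_trans w_big; rewrite -addnA leq_addr.
pose Q := (w * w)%N; have QF : [pchar F].-nat Q by rewrite pnatM wF.
have Q_gt1 : (1 < Q)%N by rewrite /Q; nia.
pose X := frob_fixed F Q.
have XP x : (x \in X) = (x ^+ Q == x) := mem_frob_fixed x Q_gt1.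
pose good x := G.[x] != 0.
have -> : \sum_(x <- X) val x = \sum_(x <- X | good x) val x.
  rewrite big_seq_cond [RHS]big_seq_cond [RHS]big_mkcondr [LHS]big_mkcondr /=.
  apply: eq_bigr => x; rewrite XP => /eqP xQ; case: ifP => // /negbFE /eqP.
  by move/(val0 x xQ).
have GH x : G.[x] = H.[x] ^+ k by rewrite -HG horner_exp.
(* raising the coefficients of [H] to the [Q] does not change [H ^ k = G],
   hence multiplies [H] by a constant, which determines the coset *)
have [c cP] : exists c, forall x, x \in X -> good x -> H.[x] ^+ Q.-1 = c.
  have dH : map_poly (frob QF) H %| H.
    rewrite -(dvdp_pexp2r _ _ k_gt0) -rmorphXn /= HG.
    rewrite (_ : map_poly _ G = G) //.
    by apply/polyP=> i; rewrite coef_map /= /frob GQ.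
  have /eqpP [[c1 c2] /= /andP [c10 c20] cE] : map_poly (frob QF) H %= H.
    by rewrite -dvdp_size_eqp // size_map_poly.
  exists (c2 / c1) => x; rewrite XP => /eqP xQ gx.
  have Hx : H.[x] != 0 by apply: contraNneq gx => Hx; rewrite GH Hx expr0n gtn_eqF.
  apply: (mulIf Hx); rewrite -exprSr prednK ?(ltnW Q_gt1) // (horner_frob QF) xQ.
  apply: (mulfI c10); rewrite -hornerZ cE hornerZ mulrA mulrCA mulfV //.
  by rewrite mulr1.
(* a point where [G] does not vanish serves to name the coset, and as the
   base point of the auxiliary polynomials *)
have [none|] := boolP (all (fun x => ~~ good x) X).
  rewrite big_seq_cond big_pred0 ?normr0 ?ler0n // => x.
  by case: (boolP (x \in X)) => // /(allP none) /negPf.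
rewrite -has_predC => /hasP [b bX /negPn gb].
have bQ : b ^+ Q = b by apply/eqP; rewrite -XP.
have [k0 bk0 _] := valP b bQ gb.
pose expo (j : nat) := (k0 + k * j)%N.
have NQ : (n * (k * N0)).+1 = (w * w)%N by rewrite mulnA (mulnC n) kn.
have exists_class x : x \in X -> good x -> exists j : 'I_n, G.[x] ^+ N0 = theta ^+ expo j.
  move=> xX gx; have /eqP xQ : x ^+ Q == x by rewrite -XP.
  have [k1 xk1 _] := valP x xQ gx.
  have power_n y : G.[y] ^+ N0 ^+ n = H.[y] ^+ Q.-1.
    by rewrite GH -!exprM /Q -NQ; congr (_ ^+ _); rewrite /=; ring.
  have : theta ^+ (k1 * n) == theta ^+ (k0 * n).
    by rewrite !exprM -xk1 -bk0 !power_n !cP.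
  rewrite (eq_prim_root_expr thetaP) -kn -!muln_modl eqn_pmul2r // => k01.
  have le01 : (k0 <= k1 + k0 * e)%N.
    by rewrite (leq_trans (leq_pmulr _ e_gt0)) ?leq_addl.
  have /dvdnP [t tE] : (k %| k1 + k0 * e - k0)%N.
    by rewrite -eqn_mod_dvd // -kn -modnDmr mulnCA modnMr addn0.
  exists (Ordinal (ltn_pmod t n_gt0)); apply/eqP.
  rewrite xk1 (eq_prim_root_expr thetaP) /=.
  rewrite /expo muln_modr kn modnDmr (mulnC k t) -tE subnKC //.
  by rewrite addnC modnMDl.
pose cls x := odflt (Ordinal n_gt0) [pick j : 'I_n | G.[x] ^+ N0 == theta ^+ expo j].
have clsP x : x \in X -> good x -> G.[x] ^+ N0 = theta ^+ expo (cls x).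
  move=> xX gx; rewrite /cls; case: pickP => [j /eqP //|none].
  by have [j jE] := exists_class x xX gx; have := none j; rewrite jE eqxx.
pose T j := [seq x <- X | good x && (cls x == j)].
have sumT : \sum_(x <- X | good x) val x = \sum_(j < n) xi ^+ expo j * (size (T j))%:R.
  rewrite (partition_big cls xpredT) //=; apply: eq_bigr => j _.
  rewrite -big_filter -/(T j) (eq_big_seq (fun=> xi ^+ expo j)) => [|x].
    by rewrite big_const_seq count_predT iter_addr_0 mulr_natr.
  rewrite mem_filter => /andP [/andP [gx /eqP clsx] xX].
  have /eqP xQ : x ^+ Q == x by rewrite -XP.
  have [k1 xk1 ->] := valP x xQ gx; apply/eqP; rewrite (eq_prim_root_expr xiP).
  by rewrite -(eq_prim_root_expr thetaP) -xk1 clsP // clsx.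
have T_hi j : (n * size (T j) <= Q + C1 * w)%N.
  apply: (stepanov_bound (z := theta ^+ expo j) n_gt0 wF NQ w_big nH (b := b)).
  - by apply: contraNneq gb => Hb; rewrite GH Hb expr0n gtn_eqF.
  - by rewrite filter_uniq // frob_fixed_uniq.
  move=> x; rewrite mem_filter => /andP [/andP [gx /eqP <-] xX]; split.
  - by apply/eqP; rewrite -XP.
  - by apply: contraNneq gx => Hx; rewrite GH Hx expr0n gtn_eqF.
  by rewrite exprM -GH clsP.
have T_lo : (Q <= \sum_(j < n) size (T j) + size G)%N.
  have -> : (\sum_(j < n) size (T j) = count good X)%N.
    rewrite -sum1_count (partition_big cls xpredT) //=; apply: eq_bigr => j _.
    by rewrite sum1_count size_filter.
  have := count_predC good X; rewrite size_frob_fixed // => <-.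
  rewrite leq_add2l -size_filter ltnW // max_poly_roots //.
    by apply/allP=> x; rewrite mem_filter => /andP [/negPn].
  by rewrite filter_uniq // frob_fixed_uniq.
have xi_norm j : `|xi ^+ j| = 1 by rewrite normrX (norm_prim_root xiP) expr1n.
pose B := (Q + C1 * w)%N.
have sumE : n%:R * (\sum_(j < n) xi ^+ expo j * (size (T j))%:R) =
    - \sum_(j < n) xi ^+ expo j * (B - n * size (T j))%:R.
  apply/eqP; rewrite -addr_eq0 mulr_sumr -big_split /=.
  rewrite (eq_bigr (fun j : 'I_n => xi ^+ k0 * B%:R * xi ^+ (k * j))) => [|j _].
    by rewrite -mulr_sumr (sum_primitive_root_power xiP kn n_gt1) mulr0.
  rewrite natrB // natrM /expo exprD; ring.
rewrite sumT -(@ler_pM2l _ n%:R) ?ltr0n // -[X in X * `|_|]normr_nat -normrM sumE.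
rewrite normrN; apply: le_trans (ler_norm_sum _ _ _) _.
under eq_bigr => j _ do rewrite normrM xi_norm mul1r normr_nat.
rewrite -natr_sum -natrM ler_nat sumnB // sum_nat_const card_ord -big_distrr /=.
rewrite -mulnBr leq_pmul2l // leq_subLR.
apply: (@leq_trans (\sum_(j < n) size (T j) + size G + C1 * w)).
  by rewrite leq_add2r.
rewrite -addnA leq_add2l addnC !mulnDl -addnA; apply: leq_trans (leq_addl _ _).
by rewrite leq_add2l leq_pmulr // ltnW.
Qed.

(** * Frobenius orbits of the roots of a polynomial *)

Section Orbits.

Variables (F : closedFieldType) (q : nat).
Hypotheses (q_gt1 : (1 < q)%N) (qF : [pchar F].-nat q).

Lemma pchar_nat_exp r : [pchar F].-nat (q ^ r)%N.
Proof. by rewrite pnatX qF. Qed.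

Lemma frob_inj r : injective (fun x : F => x ^+ (q ^ r)).
Proof. exact: (fmorph_inj (frob (pchar_nat_exp r))). Qed.

(** For [a] of period dividing [r], the characteristic polynomial of [a] over
    the field with [q] elements, [a] being seen in the field with [q ^ r]
    elements: a power of its minimal polynomial. *)
Definition cyc (r : nat) (a : F) : {poly F} :=
  \prod_(i < r) ('X - (a ^+ (q ^ i))%:P).

Lemma cyc_size r a : size (cyc r a) = r.+1.
Proof. by rewrite size_prod_XsubC /index_enum -enumT size_enum_ord. Qed.

Lemma cyc_monic r a : cyc r a \is monic.
Proof. exact: monic_prod_XsubC. Qed.

Lemma cyc_frob r a : a ^+ (q ^ r) = a ->
  map_poly (frob qF) (cyc r a) = cyc r a.
Proof.
move=> ar; rewrite map_prod_XsubC /=.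
under eq_bigr => i _ do rewrite /frob -exprM -expnSr.
case: r ar => [|r] ar; first by rewrite /cyc !big_ord0.
by rewrite /cyc big_ord_recr big_ord_recl /= ar expn0 expr1 mulrC.
Qed.

Lemma cycD r s a : a ^+ (q ^ s) = a -> cyc (s + r) a = cyc s a * cyc r a.
Proof.
move=> as_; rewrite /cyc big_split_ord /=; congr (_ * _).
by apply: eq_bigr => i _; rewrite expnD exprM as_.
Qed.

Lemma root_frob (g : {poly F}) a k :
  map_poly (frob qF) g = g -> ('X - a%:P) ^+ k %| g -> 
  forall i, ('X - (a ^+ (q ^ i))%:P) ^+ k %| g.
Proof.
move=> gq ag; elim=> [|i IHi]; first by rewrite expr1.
rewrite -gq; suff <- : map_poly (frob qF) (('X - (a ^+ (q ^ i))%:P) ^+ k) =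
    ('X - (a ^+ (q ^ i.+1))%:P) ^+ k by rewrite dvdp_map.
rewrite rmorphXn rmorphB /= map_polyX map_polyC /= /frob.
by rewrite -exprM -expnSr.
Qed.

(** All [a ^ (q ^ i)] are roots of [g], so two of them coincide; the [q]-power
    map being injective, the orbit of [a] is periodic from the start. *)
Lemma frob_period (g : {poly F}) a : g != 0 ->
  map_poly (frob qF) g = g -> root g a ->
  exists2 r, (0 < r)%N & a ^+ (q ^ r) = a.
Proof.
move=> g0 gq ag.
have all_roots : all (root g) [seq a ^+ (q ^ i) | i <- iota 0 (size g)].
  apply/allP=> _ /mapP [i _ ->]; rewrite -dvdp_XsubCl -[_ - _]expr1.
  by apply: root_frob => //; rewrite expr1 dvdp_XsubCl.
have : ~~ uniq [seq a ^+ (q ^ i) | i <- iota 0 (size g)].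
  apply/negP=> u; have := max_poly_roots g0 all_roots u.
  by rewrite size_map size_iota ltnn.
case/(uniqPn 0)=> i [j []]; rewrite size_map size_iota => ij jg.
rewrite !(nth_map 0%N) ?size_iota ?nth_iota ?(ltn_trans ij) // !add0n => E.
exists (j - i)%N; first by rewrite subn_gt0.
apply: (@frob_inj i); rewrite -exprM -expnD subnK ?(ltnW ij) //.
Qed.

(** Let [d] be the exact period of [a].  Then [a ^ (q ^ r) = a] exactly when
    [d] divides [r], in which case [cyc r a] is the [r / d]-th power of the
    product over the [d] distinct conjugates, all of which have the same
    multiplicity in [g]. *)
Lemma cyc_period_dvd (g : {poly F}) a : g != 0 ->
  map_poly (frob qF) g = g -> root g a ->
  exists2 d, (0 < d)%N & forall r,
    (a ^+ (q ^ r) == a) && (cyc r a %| g) =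
    (d %| r)%N && (r %/ d <= mup a g)%N.
Proof.
move=> g0 gq ag; have [r0 r0_gt0 r0P] := frob_period g0 gq ag.
pose per r := (0 < r)%N && (a ^+ (q ^ r) == a).
have exper : exists r, per r by exists r0; rewrite /per r0_gt0 r0P eqxx.
case: (ex_minnP exper) => d /andP [d_gt0 /eqP dP] dmin.
exists d => // r.
have perM k : a ^+ (q ^ (k * d)) = a.
  by elim: k => [|k IHk]; rewrite ?expr1 // mulSn expnD exprM dP.
have cycM k : cyc (k * d) a = cyc d a ^+ k.
  elim: k => [|k IHk]; first by rewrite /cyc big_ord0 expr0.
  by rewrite mulSn cycD // IHk exprS.
have -> : (a ^+ (q ^ r) == a) = (d %| r)%N.
  apply/eqP/idP=> [ar|/dvdnP [k ->] //].
  have : a ^+ (q ^ (r %% d)) = a.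
    by rewrite -{2}ar {2}(divn_eq r d) expnD exprM perM.
  rewrite /dvdn; case: posnP => // r_gt0 /eqP ar'.
  have := dmin (r %% d)%N; rewrite /per r_gt0 ar' => /(_ isT).
  by rewrite leqNgt ltn_pmod.
case: (boolP (d %| r)%N) => //= /dvdnP [k ->]; rewrite mulnK // cycM mup_geq //.
apply/idP/idP => [|ak].
  apply: dvdp_trans; apply: dvdp_exp2r; rewrite /cyc.
  case: (d) d_gt0 => // d' _; rewrite big_ord_recl /= expn0 expr1.
  by rewrite dvdp_mulr.
rewrite /cyc -prodrXl.
have -> : \prod_(i < d) ('X - (a ^+ (q ^ i))%:P) ^+ k =
    \prod_(b <- [seq a ^+ (q ^ i) | i <- iota 0 d]) ('X - b%:P) ^+ k.
  rewrite big_map -(big_mkord xpredT (fun i => ('X - (a ^+ (q ^ i))%:P) ^+ k)).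
  by rewrite /index_iota subn0.
apply: dvdp_prod_XsubC_exp; last first.
  by move=> _ /mapP [i _ ->]; apply: root_frob.
rewrite map_inj_in_uniq ?iota_uniq // => i j; rewrite !mem_iota !add0n /=.
wlog ij : i j / (i <= j)%N.
  by move=> W id jd E; case: (leqP i j) => [/W|/ltnW /W W']; [exact | rewrite W'].
move=> id jd E; apply/eqP; rewrite eqn_leq ij leqNgt; apply/negP=> ltij.
have : a ^+ (q ^ (j - i)) = a.
  by apply: (@frob_inj i); rewrite -exprM -expnD subnK // /= E.
move/eqP=> per_ji; have := dmin (j - i)%N.
by rewrite /per subn_gt0 ltij per_ji => /(_ isT); lia.
Qed.

Lemma count_multiples (d M n : nat) : (0 < d)%N -> (M * d <= n)%N ->
  (\sum_(r < n) ((d %| r.+1) && (r.+1 %/ d <= M)))%N = M.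
Proof.
move=> d_gt0 Mn.
rewrite -(big_mkord xpredT (fun r => ((d %| r.+1) && (r.+1 %/ d <= M) : nat)%N)).
rewrite -big_mkcond /= sum1_count -size_filter.
rewrite -[RHS](size_iota 1) -[RHS](size_map (fun k => (k * d).-1)).
apply: perm_size; apply: uniq_perm; first by rewrite filter_uniq ?iota_uniq.
  rewrite map_inj_in_uniq ?iota_uniq // => i j; rewrite !mem_iota => ? ? ?; nia.
move=> r; rewrite mem_filter mem_index_iota; apply/idP/mapP.
  case/andP=> /andP [/dvdnP [k rk] kM] _; exists k; last by rewrite -rk.
  by rewrite rk mulnK // in kM; rewrite mem_iota; nia.
case=> k; rewrite mem_iota => /andP [k_gt0 kM] ->.
rewrite prednK ?muln_gt0 ?k_gt0 // dvdn_mull // mulnK //; nia.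
Qed.

(** A root of [g] of period [d] is counted for [d], [2 * d] and so on, as many
    times as its multiplicity, and the multiplicities add up to the degree. *)
Lemma count_cyc_dvd (g : {poly F}) n : g \is monic -> size g = n.+1 ->
  map_poly (frob qF) g = g ->
  (\sum_(r < n) count (fun a => (cyc r.+1 a %| g)%R) (frob_fixed F (q ^ r.+1)))%N = n.
Proof.
move=> gm gn gq; have g0 := monic_neq0 gm.
have [s sE] := closed_field_poly_normal g.
rewrite (monicP gm) scale1r in sE.
have ss : size s = n by apply: succn_inj; rewrite -gn sE (size_prod_XsubC _ id).
have rootE a : root g a = (a \in undup s) by rewrite mem_undup sE root_prod_XsubC.
have cyc_count r : count (fun a => (cyc r.+1 a %| g)%R) (frob_fixed F (q ^ r.+1)) =
    (\sum_(a <- undup s) ((a ^+ (q ^ r.+1) == a) && (cyc r.+1 a %| g)%R))%N.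
  rewrite -big_mkcond /= sum1_count -!size_filter; apply: perm_size.
  apply: uniq_perm; rewrite ?filter_uniq ?frob_fixed_uniq ?undup_uniq // => a.
  rewrite !mem_filter mem_frob_fixed ?(ltn_exp2l 0) //.
  rewrite -rootE; case: (boolP (cyc _ _ %| g)) => //=; rewrite ?andbF // andbT.
  move=> cg; rewrite -[LHS]andbT; congr (_ && _); symmetry.
  rewrite -dvdp_XsubCl; apply: dvdp_trans cg; rewrite /cyc big_ord_recl.
  by rewrite expn0 expr1 dvdp_mulr.
under eq_bigr => r _ do rewrite cyc_count.
rewrite exchange_big /= -[RHS]ss -sum1_size -[RHS]big_undup_iterop_count /=.
rewrite big_seq [RHS]big_seq; apply: eq_bigr => a; rewrite -rootE => ag.
rewrite Monoid.iteropE iter_addn_0 mul1n -mu_prod_XsubC -sE.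
have [d d_gt0 dP] := cyc_period_dvd g0 gq ag.
under eq_bigr => r _ do rewrite dP.
apply: count_multiples => //.
have := dP (mup a g * d)%N; rewrite dvdn_mull // mulnK // leqnn => /andP [_].
by move/(dvdp_leq g0); rewrite cyc_size gn.
Qed.

End Orbits.

(** * Descent to a finite field *)

Section Descent.

Variables (F : closedFieldType) (k : finFieldType) (iota : {rmorphism k -> F}).
Let q := #|k|.

Lemma card_field_gt1 : (1 < q)%N.
Proof. exact: finNzRing_gt1. Qed.

Lemma finField_pchar_nat : [pchar F].-nat q.
Proof.
have [p p_pr pk] := finPcharP k.
have -> : [pchar F].-nat q = [pchar k].-nat q.
  by apply: eq_pnat => r; rewrite !inE -(rmorph_nat iota) fmorph_eq0.
by rewrite /q (card_pprimeChar pk) pnatX (eq_pnat _ (pcharf_eq pk)) pnat_id.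
Qed.

Lemma iota_fixed y : iota y ^+ q = iota y.
Proof. by rewrite -rmorphXn /= expf_card. Qed.

Lemma fixed_iota x : x ^+ q = x -> exists y, iota y = x.
Proof.
move=> xq; have : root (map_poly iota ('X^q - 'X)) x.
  by rewrite rmorphB /= map_polyXn map_polyX rootE !hornerE xq subrr.
rewrite finField_genPoly map_prod_XsubC -(big_map iota xpredT (fun z => 'X - z%:P)).
by rewrite root_prod_XsubC => /mapP [y _ ->]; exists y.
Qed.

Definition descend (u : {poly F}) : {poly k} :=
  \poly_(i < size u) odflt 0 [pick y | iota y == u`_i].

Lemma descendK u : map_poly (frob finField_pchar_nat) u = u ->
  map_poly iota (descend u) = u.
Proof.
move=> uq; apply/polyP=> i; rewrite coef_map coef_poly.
case: ltnP => [_|iu] /=; last by rewrite [RHS]nth_default // rmorph0.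
case: pickP => [y /eqP //|none].
have [y yE] : exists y, iota y = u`_i.
  by apply: fixed_iota; rewrite -{2}uq coef_map.
by have := none y; rewrite yE eqxx.
Qed.

Lemma frob_map_iota (u : {poly k}) :
  map_poly (frob finField_pchar_nat) (map_poly iota u) = map_poly iota u.
Proof. by apply/polyP=> i; rewrite !coef_map /= /frob iota_fixed. Qed.

End Descent.

(** * The L-function of a character sum *)

Section LFunction.

Variables (F : closedFieldType) (k : finFieldType) (iota : {rmorphism k -> F}).
Variables (C : numClosedFieldType) (Q : nat) (chi : F -> C) (d : nat).
Local Notation q := #|k|.
Let qF := finField_pchar_nat iota.
Hypothesis QE : Q = (q ^ d)%N.
Hypothesis chi1 : chi 1 = 1.
Hypothesis chiM : forall x y, x ^+ Q = x -> y ^+ Q = y -> chi (x * y) = chi x * chi y.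

Variable P : {poly F}.
Hypotheses (P0 : P != 0) (PQ : forall i, P`_i ^+ Q = P`_i).

Let QF : [pchar F].-nat Q.
Proof. by rewrite QE pnatX qF. Qed.

Definition zeros : seq F := sval (closed_field_poly_normal P).

Lemma zerosE : P = lead_coef P *: \prod_(b <- zeros) ('X - b%:P).
Proof. by rewrite /zeros; case: closed_field_poly_normal. Qed.

Definition zeros_prod (g : {poly F}) : F := \prod_(b <- zeros) g.[b].

Definition norm_const : F := lead_coef P * (-1) ^+ size zeros.

(** For monic [g], the product of the values of [P] at the roots of [g]: the
    resultant of the two, written as a product over the zeros of [P].  In this
    form it visibly depends only on the degree of [g] and on its values at
    the zeros of [P]. *)
Definition poly_norm (g : {poly F}) : F :=
  norm_const ^+ (size g).-1 * zeros_prod g.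

Lemma zeros_prodM g h : zeros_prod (g * h) = zeros_prod g * zeros_prod h.
Proof. by rewrite -big_split; apply: eq_bigr => b _; rewrite hornerM. Qed.

Lemma poly_normM g h : g \is monic -> h \is monic ->
  poly_norm (g * h) = poly_norm g * poly_norm h.
Proof.
move=> gm hm; rewrite /poly_norm zeros_prodM size_monicM ?monic_neq0 //.
have := monic_neq0 gm; have := monic_neq0 hm; rewrite -!size_poly_gt0.
move=> h_gt0 g_gt0; rewrite mulrACA -exprD; congr (_ ^+ _ * _).
by rewrite -(prednK g_gt0) -(prednK h_gt0) addSn addnS.
Qed.

Lemma poly_norm1 : poly_norm 1 = 1.
Proof.
rewrite /poly_norm size_poly1 mul1r /zeros_prod.
by rewrite big1 // => b _; rewrite hornerC.
Qed.

Lemma poly_norm_XsubC a : poly_norm ('X - a%:P) = P.[a].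
Proof.
rewrite /poly_norm size_XsubC expr1 [in RHS]zerosE hornerZ horner_prod.
rewrite /norm_const -mulrA; congr (_ * _); rewrite /zeros_prod.
rewrite -[X in (-1) ^+ X]sum1_size -prodrXr -big_split /=.
by apply: eq_bigr => b _; rewrite !hornerE expr1 mulN1r opprB.
Qed.

Lemma poly_norm_cyc r a : poly_norm (cyc q r a) = \prod_(i < r) P.[a ^+ (q ^ i)].
Proof.
rewrite /cyc; elim: r => [|r IHr]; first by rewrite !big_ord0 poly_norm1.
rewrite !big_ord_recr /= poly_normM ?monic_prod_XsubC ?monicXsubC //.
by rewrite IHr poly_norm_XsubC.
Qed.

(** The zeros of [P] are permuted by the [Q]-power map, with their
    multiplicities, since it fixes the coefficients of [P]. *)
Lemma zeros_frob : perm_eq [seq b ^+ Q | b <- zeros] zeros.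
Proof.
have fixP : map_poly (frob QF) P = P.
  by apply/polyP=> i; rewrite coef_map /= /frob PQ.
apply/allP=> x _ /=; rewrite -!mu_prod_XsubC big_map; apply/eqP; congr (mup x _).
apply: (mulfI (x := (lead_coef P)%:P)); first by rewrite polyC_eq0 lead_coef_eq0.
rewrite !mul_polyC -zerosE -[RHS]fixP [X in map_poly _ X]zerosE.
rewrite map_polyZ map_prod_XsubC /=; congr (_ *: _).
by rewrite /frob lead_coefE PQ.
Qed.

Lemma fixed_poly_horner (g : {poly F}) : map_poly (frob qF) g = g ->
  forall x i, g.[x] ^+ (q ^ i) = g.[x ^+ (q ^ i)].
Proof.
move=> gq x; elim=> [|i IHi]; first by rewrite !expr1.
by rewrite expnSr !exprM IHi (horner_frob qF) gq.
Qed.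

Lemma zeros_prod_fixed g : map_poly (frob qF) g = g ->
  zeros_prod g ^+ Q = zeros_prod g.
Proof.
move=> gq; rewrite /zeros_prod -prodrXl.
rewrite -[RHS](perm_big _ zeros_frob) big_map; apply: eq_bigr => b _.
by rewrite QE fixed_poly_horner.
Qed.

Lemma norm_const_fixed n : (norm_const ^+ n) ^+ Q = norm_const ^+ n.
Proof.
rewrite exprAC; congr (_ ^+ _); rewrite /norm_const exprMn lead_coefE PQ.
congr (_ * _); rewrite exprAC; congr (_ ^+ _).
by rewrite -[_ ^+ Q]/(frob QF _) rmorphN1.
Qed.

Lemma poly_norm_fixed g : map_poly (frob qF) g = g -> poly_norm g ^+ Q = poly_norm g.
Proof. by move=> gq; rewrite exprMn norm_const_fixed zeros_prod_fixed. Qed.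

Definition char_sum (r : nat) : C :=
  \sum_(a <- frob_fixed F (q ^ r)) chi (\prod_(i < r) P.[a ^+ (q ^ i)]).

Definition monic_of n (p : {poly k}) : {poly k} := 'X^n + p.

Lemma size_monic_of n (p : {poly k}) : (size p <= n)%N -> size (monic_of n p) = n.+1.
Proof. by move=> pn; rewrite size_polyDl size_polyXn // ltnS. Qed.

Lemma monic_of_monic n (p : {poly k}) : (size p <= n)%N -> monic_of n p \is monic.
Proof. by move=> pn; rewrite monicE lead_coefDl ?lead_coefXn // size_polyXn ltnS. Qed.

(** The coefficients of the L-function, the sum of
    [chi (poly_norm g) * T ^ deg g] over the monic polynomials [g] over [k]. *)
Definition Lcoef (n : nat) : C :=
  \sum_(p : {poly_n k}) chi (poly_norm (map_poly iota (monic_of n p))).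

Lemma Lcoef0 : Lcoef 0 = 1.
Proof.
have zero0 (p : {poly_0 k}) : p = 0.
  by apply: val_inj => /=; apply/size_poly_leq0P/size_npoly.
rewrite /Lcoef (bigD1 (0 : {poly_0 k})) //= big1 => [|p]; last first.
  by rewrite (zero0 p) eqxx.
by rewrite addr0 /monic_of expr0 addr0 rmorph1 poly_norm1 chi1.
Qed.

Lemma monic_sub_size n (g : {poly k}) :
  g \is monic -> size g = n.+1 -> (size (g - 'X^n)%R <= n)%N.
Proof.
move=> gm gn; apply/leq_sizeP => i ni; rewrite coefB coefXn.
have [->|ni'] := eqVneq i n; last first.
  by rewrite subr0 nth_default // gn ltn_neqAle eq_sym ni'.
by have := monicP gm; rewrite lead_coefE gn /= => ->; rewrite subrr.
Qed.

Lemma sum_multiples n r (u : {poly k}) (f : {poly k} -> C) :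
  (r <= n)%N -> u \is monic -> size u = r.+1 ->
  \sum_(p : {poly_n k} | u %| monic_of n p) f (monic_of n p) =
  \sum_(p : {poly_(n - r) k}) f (u * monic_of (n - r) p).
Proof.
move=> rn um ur.
pose h (p : {poly_(n - r) k}) : {poly_n k} :=
  npolyp n (u * monic_of (n - r) p - 'X^n).
pose h' (p : {poly_n k}) : {poly_(n - r) k} :=
  npolyp (n - r) (monic_of n p %/ u - 'X^(n - r)).
have hE p : monic_of n (h p) = u * monic_of (n - r) p.
  rewrite /monic_of npolypK ?[_ + (_ - _)]addrC ?subrK // -/(monic_of _ _).
  apply: monic_sub_size; first by rewrite monicMl // monic_of_monic ?size_npoly.
  rewrite size_monicM ?monic_neq0 ?monic_of_monic ?size_npoly //.
  by rewrite ur size_monic_of ?size_npoly // addSn addnS /= subnKC.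
have h'E (p : {poly_n k}) : u %| monic_of n p ->
    u * monic_of (n - r) (h' p) = monic_of n p.
  move=> up; rewrite /monic_of npolypK; last first.
    apply: monic_sub_size.
      by rewrite -(monicMl _ um) mulrC divpK // monic_of_monic ?size_npoly.
    rewrite size_divp ?monic_neq0 // size_monic_of ?size_npoly // ur /=.
    by rewrite subSn.
  by rewrite [X in u * X]addrC subrK mulrC divpK.
rewrite (reindex_onto h h') => [|p up]; last first.
  by apply/val_inj/(addrI 'X^n); rewrite -/(monic_of n _) hE h'E.
apply: eq_big => [p|p _]; rewrite hE // dvdp_mulr //=; apply/eqP/val_inj.
apply/(addrI 'X^(n - r))/(mulfI (monic_neq0 um)).
by rewrite -/(monic_of _ (h' (h p))) h'E hE // dvdp_mulr.
Qed.

(** The term [char_sum r * Lcoef (n - r)] is the sum of [chi (poly_norm g)]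
    over the pairs of a point [a] and a multiple [g] of [cyc r a] of degree
    [n]; each [g] then occurs [n] times by [count_cyc_dvd]. *)
Lemma Lcoef_newton n :
  n%:R * Lcoef n = \sum_(r < n) char_sum r.+1 * Lcoef (n - r.+1).
Proof.
have q_gt1 : (1 < q)%N := card_field_gt1 k.
pose f g := chi (poly_norm (map_poly iota g)).
pose c r a := descend iota (cyc q r a).
have step (r : 'I_n) : char_sum r.+1 * Lcoef (n - r.+1) =
    \sum_(a <- frob_fixed F (q ^ r.+1))
      \sum_(p : {poly_n k} | cyc q r.+1 a %| map_poly iota (monic_of n p))
        f (monic_of n p).
  rewrite mulr_suml big_seq [RHS]big_seq; apply: eq_bigr => a.
  rewrite mem_frob_fixed ?(ltn_exp2l 0) // => /eqP aq.
  have cE : map_poly iota (c r.+1 a) = cyc q r.+1 a.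
    by apply: descendK; apply: cyc_frob.
  have cm : c r.+1 a \is monic by rewrite -(map_monic iota) cE cyc_monic.
  have cs : size (c r.+1 a) = r.+2 by rewrite -(size_map_poly iota) cE cyc_size.
  rewrite [RHS](eq_bigl (fun p : {poly_n k} => c r.+1 a %| monic_of n p)); last first.
    by move=> p; rewrite -cE dvdp_map.
  rewrite (sum_multiples _ _ cm cs) // -poly_norm_cyc -cE mulr_sumr.
  apply: eq_bigr => p _; rewrite /f rmorphM /= poly_normM ?map_monic //.
    by rewrite chiM // poly_norm_fixed // frob_map_iota.
  by rewrite monic_of_monic // size_npoly.
under eq_bigr => r _ do rewrite step.
under eq_bigr => r _ do rewrite (exchange_big_dep xpredT) //=.
rewrite exchange_big /= mulr_sumr; apply: eq_bigr => p _.
rewrite -[X in X%:R](@count_cyc_dvd _ q q_gt1 qF (map_poly iota (monic_of n p))).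
- rewrite natr_sum mulr_suml; apply: eq_bigr => r _.
  by rewrite -big_filter big_const_seq count_predT size_filter iter_addr_0 mulr_natl.
- by rewrite map_monic monic_of_monic // size_npoly.
- by rewrite size_map_poly size_monic_of // size_npoly.
exact: frob_map_iota.
Qed.

Variables (M : {poly k}) (u : {poly k}).
Hypothesis M_zeros : forall b, b \in zeros -> root (map_poly iota M) b.
Hypothesis M0 : M != 0.
Hypotheses (uM : coprimep u M) (u_nontriv : chi (zeros_prod (map_poly iota u)) != 1).

(** Since [deg M <= n], the map that sends a monic [g] to the polynomial
    congruent to [u * g] modulo [M] and with the same quotient by [M]
    permutes the monic polynomials of degree [n].  It multiplies the sum by
    the value of the character at [u], which is not 1. *)
Lemma Lcoef_vanish n : ((size M).-1 <= n)%N -> Lcoef n = 0.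
Proof.
move=> Mn; pose psi (g : {poly k}) := chi (zeros_prod (map_poly iota g)).
pose h (p : {poly_n k}) : {poly_n k} :=
  npolyp n ((p : {poly k}) + ((u - 1) * monic_of n p) %% M).
have hE p : monic_of n (h p) = monic_of n p + ((u - 1) * monic_of n p) %% M.
  rewrite /monic_of /h npolypK -/(monic_of n p) ?addrA //.
  apply: leq_trans (size_polyD _ _) _; rewrite geq_max size_npoly.
  apply: leq_trans Mn; have := ltn_modp ((u - 1) * monic_of n p) M.
  by rewrite M0; case: (size M).
have h_inj : injective h.
  move=> p1 p2 E; apply/val_inj/(addrI 'X^n); rewrite -!/(monic_of n _).
  have := congr1 (fun p : {poly_n k} => monic_of n p) E; rewrite !hE.
  set g1 := monic_of n p1; set g2 := monic_of n p2 => E12.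
  have mod_u g : (g + ((u - 1) * g) %% M) %% M = (u * g) %% M.
    by rewrite modpD modp_id -modpD mulrBl mul1r addrC subrK.
  have mod12 : g1 %% M = g2 %% M.
    apply/eqP; rewrite -subr_eq0 -modpN -modpD -/(dvdp M _).
    rewrite -(Gauss_dvdpr _ (_ : coprimep M u)) 1?coprimep_sym // mulrBr.
    by rewrite /dvdp modpD modpN subr_eq0 -!mod_u E12.
  move: E12; rewrite -modp_mul mod12 modp_mul; exact: addIr.
have psi_h p : psi (monic_of n (h p)) = psi u * psi (monic_of n p).
  rewrite /psi -chiM ?zeros_prod_fixed ?frob_map_iota // -zeros_prodM -rmorphM /=.
  rewrite hE; congr (chi _); apply: eq_big_seq => b /M_zeros /rootP Mb.
  set x := (u - 1) * _; have := divp_eq x M; rewrite addrC => /eqP.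
  rewrite -subr_eq => /eqP <-; rewrite /x mulrBl mul1r addrA (addrCA _ (u * _)).
  by rewrite subrr addr0 rmorphB hornerD hornerN !rmorphM /= !hornerM Mb mulr0 subr0.
have L_psi : Lcoef n = chi (norm_const ^+ n) * \sum_(p : {poly_n k}) psi (monic_of n p).
  rewrite mulr_sumr; apply: eq_bigr => p _; rewrite /poly_norm.
  rewrite size_map_poly size_monic_of ?size_npoly //= chiM //.
    exact: norm_const_fixed.
  by rewrite zeros_prod_fixed ?frob_map_iota.
rewrite L_psi; set s := \sum_(p | _) _; suff -> : s = 0 by rewrite mulr0.
have sE : s = psi u * s.
  rewrite {1}/s (reindex_inj h_inj) mulr_sumr /=.
  by apply: eq_bigr => p _; rewrite psi_h.
apply/eqP; have /eqP := sE; rewrite -subr_eq0 -{1}[s]mul1r -mulrBl mulf_eq0.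
by rewrite subr_eq0 eq_sym (negPf u_nontriv).
Qed.

End LFunction.

(** * Newton identities and the growth of power sums *)

(** The polynomial with constant term 1 whose reciprocal roots are the entries
    of [s]: the shape of an L-function. *)
Definition rev_prod (C : nzRingType) (s : seq C) : {poly C} :=
  \prod_(w <- s) (1 - w *: 'X).

Lemma rev_prod0 (C : comNzRingType) (s : seq C) : (rev_prod s)`_0 = 1.
Proof.
rewrite -horner_coef0 horner_prod big1 // => x _.
by rewrite !hornerE ?mulr0 ?subr0.
Qed.

(** By induction on [s]: for a new entry [w] the additional terms on the right
    form a telescoping sum. *)
Lemma newton_identity (C : comNzRingType) (s : seq C) n :
  n%:R * (rev_prod s)`_n =
  - \sum_(r < n) (\sum_(w <- s) w ^+ r.+1) * (rev_prod s)`_(n - r.+1).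
Proof.
rewrite /rev_prod; elim: s n => [|w s IHs] n.
  rewrite big_nil big1 ?oppr0 => [|r _]; last by rewrite big_nil mul0r.
  by rewrite coef1; case: n => [|n]; rewrite ?mul0r ?mulr0.
rewrite big_cons; set p := \prod_(_ <- s) _ in IHs *.
pose S r : C := \sum_(v <- s) v ^+ r.
have coef0E : ((1 - w *: 'X) * p)`_0 = p`_0.
  by rewrite mulrBl mul1r -scalerAl coefB coefZ coefXM mulr0 subr0.
have coefE i : ((1 - w *: 'X) * p)`_i.+1 = p`_i.+1 - w * p`_i.
  by rewrite mulrBl mul1r -scalerAl coefB coefZ coefXM.
case: n => [|n]; first by rewrite mul0r big_ord0 oppr0.
have tel : \sum_(r < n) (w ^+ r.+1 * p`_(n - r) - w ^+ r.+2 * p`_(n - r.+1)) =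
    w * p`_n - w ^+ n.+1 * p`_0.
  rewrite -(big_mkord xpredT
    (fun r => w ^+ r.+1 * p`_(n - r) - w ^+ r.+2 * p`_(n - r.+1))).
  rewrite (telescope_sumr_eq (fun r => - (w ^+ r.+1 * p`_(n - r)))) // => [|r _].
    by rewrite subnn subn0 expr1 opprK addrC.
  by rewrite opprK addrC.
rewrite big_ord_recr /= subSS subnn coef0E big_cons coefE.
rewrite (eq_bigr (fun r : 'I_n => (w ^+ r.+1 * p`_(n - r) - w ^+ r.+2 * p`_(n - r.+1))
  + ((\sum_(v <- s) v ^+ r.+1) * p`_(n - r) -
     w * ((\sum_(v <- s) v ^+ r.+1) * p`_(n - r.+1))))) => [|r _]; last first.
  rewrite big_cons subSS -(subnSK (ltn_ord r)) coefE (exprS w r.+1); ring.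
rewrite big_split /= tel sumrB -mulr_sumr.
have := IHs n.+1; rewrite big_ord_recr /= subSS subnn => E1.
have E2 := IHs n; rewrite mulrBr E1 mulrCA -natr1 mulrDl mul1r E2.
under [X in - (X + _)]eq_bigr => r _ do rewrite subSS.
ring.
Qed.

(** The identities determine [S] from [L] recursively, and the power sums of
    the reciprocal roots of the polynomial with coefficients [L] satisfy
    them. *)
Lemma newton_unique (C : closedFieldType)
  (L S : nat -> C) D :
  L 0 = 1 -> (forall n, (D <= n)%N -> L n = 0) ->
  (forall n, n%:R * L n = \sum_(r < n) S r.+1 * L (n - r.+1)%N) ->
  exists2 s : seq C, (size s < D)%N &
    forall n, (0 < n)%N -> S n = - \sum_(w <- s) w ^+ n.
Proof.
move=> L0 LD LS.
have D_gt0 : (0 < D)%N.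
  by rewrite lt0n; apply: contra_neqN (oner_neq0 C) => /eqP D0; rewrite -L0 LD ?D0.
pose l := \poly_(i < D) L i.
have lE n : l`_n = L n by rewrite coef_poly; case: ltnP => // /LD.
have [s sE] : exists2 s : seq C, (size s < D)%N & l = rev_prod s.
  have [z zE] := closed_field_poly_normal l.
  have l0 : l != 0.
    by apply: contraTneq (oner_neq0 C) => l0; rewrite -L0 -lE l0 coef0 eqxx.
  have z0 : 0 \notin z.
    rewrite -root_prod_XsubC -(rootZ _ _ (_ : lead_coef l != 0)) ?lead_coef_eq0 //.
    by rewrite -zE rootE horner_coef0 lE L0 oner_eq0.
  exists [seq x^-1 | x <- z].
    have sz : size l = (size z).+1.
      by rewrite {1}zE size_scale ?lead_coef_eq0 // (size_prod_XsubC _ id).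
    by rewrite size_map -ltnS -sz ltnS size_poly.
  have E : l = (lead_coef l * \prod_(x <- z) (- x)) *: rev_prod [seq x^-1 | x <- z].
    rewrite {1}zE -scalerA; congr (_ *: _); rewrite /rev_prod big_map -scaler_prod.
    rewrite big_seq [RHS]big_seq; apply: eq_bigr => x xz.
    have x0 : x != 0 by apply: contraNneq z0 => <-.
    rewrite scalerBr scalerA mulNr mulfV // scaleN1r opprK addrC.
    by rewrite scaleNr alg_polyC.
  have := lE 0%N; rewrite L0 {1}E coefZ rev_prod0.
  by rewrite mulr1 => c1; rewrite E c1 scale1r.
move=> lrev; exists s => // n; have [m] := ubnP n; elim: m n => // m IH [//|n] nm _.
have := LS n.+1; rewrite -lE lrev newton_identity !big_ord_recr /= !subnn.
rewrite rev_prod0 L0 !mulr1 opprD.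
rewrite [X in _ = X + _](_ : _ =
    - \sum_(r < n) (\sum_(w <- s) w ^+ r.+1) * (rev_prod s)`_(n.+1 - r.+1)).
  by move/addrI.
rewrite -sumrN; apply: eq_bigr => r _.
rewrite IH //; first by rewrite mulNr -lE lrev.
by have := ltn_ord r; move: nm; lia.
Qed.

(** By Bernoulli's inequality the powers of [x / y] are unbounded if
    [x > y]. *)
Lemma bounded_powers (C : numFieldType)
    (arch : forall x : C, exists n, `|x| <= n%:R) (x y c : C) :
  0 < x -> 0 < y -> (forall j, (0 < j)%N -> x ^+ j <= c * y ^+ j) -> x <= y.
Proof.
move=> x0 y0 xy; have real_xy : x \is Num.real /\ y \is Num.real by rewrite !gtr0_real.
case: real_xy => xr yr.
have [//|yx] := real_leP xr yr.
pose h := x / y - 1.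
have h0 : 0 < h by rewrite subr_gt0 ltr_pdivlMr // mul1r.
have xyE : x / y = 1 + h by rewrite /h addrC subrK.
have bern j : 1 + j%:R * h <= (x / y) ^+ j.
  elim: j => [|j IHj]; first by rewrite mul0r addr0.
  rewrite exprSr; apply: le_trans (ler_wpM2r (ltW (divr_gt0 x0 y0)) IHj).
  rewrite xyE -subr_ge0 (_ : _ - _ = j%:R * h * h); last by rewrite -natr1; ring.
  by rewrite !mulr_ge0 ?ler0n // ltW.
have [n nP] := arch (c / h).
have := xy n.+1 isT; rewrite -ler_pdivrMr ?exprn_gt0 // -expr_div_n.
have cn : c <= n.+1%:R * h.
  have c0 : 0 <= c.
    rewrite -(pmulr_lge0 _ y0) -[y]expr1.
    by apply: le_trans (xy 1%N isT); rewrite expr1 ltW.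
  rewrite -ler_pdivrMr // -[c / h]ger0_norm ?divr_ge0 // ?(ltW h0) //.
  by apply: le_trans nP _; rewrite ler_nat.
move=> le1; have := le_trans (bern n.+1) (le_trans le1 cn).
by rewrite gerDr ler10.
Qed.

(** To isolate the powers of one entry [b], combine consecutive power sums
    with the coefficients of the polynomial that vanishes at all entries
    other than [b]. *)
Lemma power_sum_bound (C : numClosedFieldType)
    (arch : forall x : C, exists n, `|x| <= n%:R)
    (s : seq C) (c y : C) : 0 < y ->
  (forall j, (0 < j)%N -> `| \sum_(w <- s) w ^+ j | <= c * y ^+ j) ->
  {in s, forall w, `|w| <= y}.
Proof.
move=> y0 sy b bs.
have [->|b0] := eqVneq b 0; first by rewrite normr0 ltW.
pose phi : {poly C} := \prod_(z <- undup s | z != b) ('X - z%:P).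
have phib : phi.[b] != 0.
  rewrite /phi horner_prod prodf_seq_neq0; apply/allP=> z _; apply/implyP=> zb.
  by rewrite !hornerE subr_eq0 eq_sym.
have phis w : w \in s -> w != b -> phi.[w] = 0.
  move=> ws wb; rewrite /phi (big_rem w) ?mem_undup //= wb hornerM.
  by rewrite !hornerE subrr mul0r.
pose m := count_mem b s.
have key j : (m%:R * phi.[b]) * b ^+ j =
    \sum_(i < size phi) phi`_i * \sum_(w <- s) w ^+ (j + i).
  under eq_bigr => i _ do rewrite mulr_sumr.
  rewrite exchange_big /=.
  have -> : \sum_(w <- s) \sum_(i < size phi) phi`_i * w ^+ (j + i) =
     \sum_(w <- s) phi.[w] * w ^+ j.
    apply: eq_bigr => w _; rewrite horner_coef mulr_suml; apply: eq_bigr => i _.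
    by rewrite exprD mulrA mulrAC.
  rewrite (bigID (pred1 b)) /= [X in _ + X]big1_seq ?addr0; last first.
    by move=> w /andP [wb ws]; rewrite phis // mul0r.
  rewrite (eq_bigr (fun _ => phi.[b] * b ^+ j)) => [|w /eqP -> //].
  by rewrite big_const_seq iter_addr_0 -/m -mulrA mulr_natl.
pose A := `|m%:R * phi.[b]|.
have A0 : 0 < A.
  rewrite normr_gt0 mulf_neq0 // pnatr_eq0 -lt0n /m -has_count.
  by apply/hasP; exists b => //=.
pose c' := (\sum_(i < size phi) `|phi`_i| * (c * y ^+ i)) / A.
apply: (@bounded_powers _ arch _ _ c') => //; first by rewrite normr_gt0.
move=> j j0; rewrite /c' mulrAC ler_pdivlMr // -normrX mulrC /A -normrM key.
apply: le_trans (ler_norm_sum _ _ _) _; rewrite mulr_suml.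
apply: ler_sum => i _; rewrite normrM -mulrA ler_wpM2l //.
by apply: le_trans (sy _ _) _; rewrite ?addn_gt0 ?j0 // addnC exprD mulrA.
Qed.

(** * The bound for the values of a polynomial *)

Section CharacterSums.

Variables (F : closedFieldType) (k : finFieldType) (iota : {rmorphism k -> F}).
Variables (C : numClosedFieldType) (Q : nat) (chi : F -> C) (d : nat).
Local Notation q := #|k|.
Let qF := finField_pchar_nat iota.
Hypotheses (QE : Q = (q ^ d)%N) (d_gt0 : (0 < d)%N).
Variables (e E : nat) (theta : F) (xi : C).
(* a character of order [e] of the field with [Q] elements, described by the
   [e]-th power residue symbol: [x ^ E = theta ^ j] implies
   [chi x = xi ^ j] *)
Hypotheses (eE : (e * E)%N = Q.-1).
Hypotheses (thetaP : e.-primitive_root theta) (xiP : e.-primitive_root xi).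
Hypothesis chi0 : chi 0 = 0.
Hypothesis chiP : forall x, x != 0 -> x ^+ Q = x ->
  exists2 j, x ^+ E = theta ^+ j & chi x = xi ^+ j.
Variable P : {poly F}.
Hypotheses (P0 : P != 0) (PQ : forall i, P`_i ^+ Q = P`_i).

Let q_gt1 : (1 < q)%N := card_field_gt1 k.
Let Q_gt1 : (1 < Q)%N.
Proof. by rewrite QE -{1}(exp1n d) ltn_exp2r. Qed.
Let QF : [pchar F].-nat Q.
Proof. by rewrite QE pnatX qF. Qed.

Lemma char_pow_eq i j : theta ^+ i = theta ^+ j -> xi ^+ i = xi ^+ j.
Proof.
by move/eqP; rewrite (eq_prim_root_expr thetaP) -(eq_prim_root_expr xiP) => /eqP.
Qed.

Lemma char1 : chi 1 = 1.
Proof.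
have [||j jE ->] := chiP (x := 1); rewrite ?oner_neq0 ?expr1n //.
by rewrite -(expr0 xi); apply: char_pow_eq; rewrite -jE expr1n expr0.
Qed.

Lemma charM x y : x ^+ Q = x -> y ^+ Q = y -> chi (x * y) = chi x * chi y.
Proof.
move=> xQ yQ; have [->|x0] := eqVneq x 0; first by rewrite mul0r chi0 mul0r.
have [->|y0] := eqVneq y 0; first by rewrite mulr0 chi0 mulr0.
have [i iE ->] := chiP x0 xQ; have [j jE ->] := chiP y0 yQ.
have [l lE ->] : exists2 l, (x * y) ^+ E = theta ^+ l & chi (x * y) = xi ^+ l.
  by apply: chiP; rewrite ?mulf_neq0 // exprMn xQ yQ.
by rewrite -exprD; apply: char_pow_eq; rewrite -lE exprMn iE jE exprD.
Qed.

Lemma char_norm x : x != 0 -> x ^+ Q = x -> `|chi x| = 1.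
Proof.
move=> x0 xQ; have [j _ ->] := chiP x0 xQ; rewrite normrX.
by rewrite (norm_prim_root xiP) expr1n.
Qed.

Lemma char_norm_le1 x : x ^+ Q = x -> `|chi x| <= 1.
Proof.
move=> xQ; have [->|x0] := eqVneq x 0; first by rewrite chi0 normr0 ler01.
by rewrite char_norm.
Qed.

Definition twisted_prod : {poly F} := \prod_(i < d) (P \Po 'X^(q ^ i)).

Lemma horner_twisted x : twisted_prod.[x] = \prod_(i < d) P.[x ^+ (q ^ i)].
Proof.
by rewrite horner_prod; apply: eq_bigr => i _; rewrite horner_comp hornerXn.
Qed.

Let QFr r : [pchar F].-nat (Q ^ r)%N.
Proof. by rewrite pnatX QF. Qed.

Lemma frob_P r : map_poly (frob (QFr r)) P = P.
Proof.
apply/polyP=> i; rewrite coef_map /= /frob.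
by elim: r => [|r IHr]; rewrite ?expr1 // expnS exprM PQ.
Qed.

Lemma frob_twisted r : map_poly (frob (QFr r)) twisted_prod = twisted_prod.
Proof.
rewrite rmorph_prod; apply: eq_bigr => i _ /=.
by rewrite map_comp_poly map_polyXn frob_P.
Qed.

Lemma twisted_coef r i : twisted_prod`_i ^+ (Q ^ r) = twisted_prod`_i.
Proof. by rewrite -{2}(frob_twisted r) coef_map. Qed.

Lemma horner_twisted_pow x r : twisted_prod.[x] ^+ (Q ^ r) = twisted_prod.[x ^+ (Q ^ r)].
Proof. by rewrite (horner_frob (QFr r)) frob_twisted. Qed.

(** [twisted_prod] has coefficients in the field with [Q = q ^ d] elements, so
    the factors can be grouped by [d] into its conjugates. *)
Lemma prod_twisted x r :
  \prod_(i < d * r) P.[x ^+ (q ^ i)] = twisted_prod.[x] ^+ (\sum_(l < r) Q ^ l).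
Proof.
elim: r => [|r IHr]; first by rewrite muln0 !big_ord0 expr0.
rewrite mulnS addnC big_split_ord /= IHr big_ord_recr exprD; congr (_ * _).
rewrite horner_twisted_pow horner_twisted; apply: eq_bigr => i _.
by rewrite -exprM QE -expnM -expnD.
Qed.

Lemma twisted_neq0 : twisted_prod != 0.
Proof.
apply/prodf_neq0 => i _; apply: comp_polyXn_neq0 => //.
by rewrite expn_gt0 ltnW.
Qed.

Variable x0 : F.
Hypothesis not_power : ~~ (e %| mup x0 twisted_prod)%N.

(** [Q ^ r = w ^ 2] with [w = q ^ (d * c.+1 * j)], the factor [c.+1] making
    [w] larger than [c]. *)
Lemma char_sum_growth : exists2 t, (0 < t)%N & exists c : nat,
  forall j, (0 < j)%N -> `|char_sum k chi P (2 * t * j)| <= c%:R * (q%:R ^+ t) ^+ j.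
Proof.
have [c cP] := large_sum_bound twisted_neq0 not_power thetaP xiP.
exists (d * c.+1)%N; first by rewrite muln_gt0 d_gt0.
exists c => j j_gt0; pose r := (2 * c.+1 * j)%N; pose w := (q ^ (d * c.+1 * j))%N.
have ww : (w * w = Q ^ r)%N.
  by rewrite QE -expnM /w -expnD /r; congr (_ ^ _)%N; ring.
have rE : (2 * (d * c.+1) * j = d * r)%N by rewrite /r; ring.
have c_w : (c < w)%N.
  apply: (@leq_trans (q ^ c.+1)); first by rewrite ltnW // ltn_expl.
  by rewrite leq_exp2l // -mulnA mulnC -mulnA leq_pmulr // muln_gt0 j_gt0.
have w_gt1 : (1 < w)%N by rewrite -{1}(expn0 q) ltn_exp2l // !muln_gt0 d_gt0.
pose N0 := (E * \sum_(l < r) Q ^ l)%N.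
have eN0 : (e * N0).+1 = (w * w)%N.
  by rewrite /N0 mulnA eE -predn_exp ww prednK // expn_gt0 ltnW.
have sum_gt0 : (0 < \sum_(l < r) Q ^ l)%N.
  have : (0 < r)%N by rewrite !muln_gt0.
  by case: (r) => // r' _; rewrite big_ord_recl.
have -> : c%:R * (q%:R ^+ (d * c.+1)) ^+ j = (c * w)%:R :> C.
  by rewrite natrM /w expnM !natrX.
have -> : char_sum k chi P (2 * (d * c.+1) * j) =
    \sum_(x <- frob_fixed F (w * w)) chi (twisted_prod.[x] ^+ (\sum_(l < r) Q ^ l)).
  rewrite /char_sum rE ww QE -expnM; apply: eq_bigr => x _.
  by rewrite prod_twisted QE.
apply: cP eN0 _ _ _ => //; first exact: ltnW.
- by rewrite /w pnatX qF.
- by move=> i; rewrite ww twisted_coef.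
- by move=> x _ Gx; rewrite Gx expr0n gtn_eqF.
move=> x xw Gx; rewrite /N0 mulnC exprM; apply: chiP; first by rewrite expf_neq0.
rewrite -exprM mulnC -(prednK (ltnW Q_gt1)) mulSn exprD (prednK (ltnW Q_gt1)).
rewrite -predn_exp -ww -[RHS]mulr1; congr (_ * _).
apply: (mulfI Gx); rewrite -exprS prednK ?muln_gt0 ?(ltnW w_gt1) //.
by rewrite ww horner_twisted_pow -ww xw mulr1.
Qed.

Variable M : {poly k}.
Hypotheses (M0 : M != 0) (MP : forall b, root P b -> root (map_poly iota M) b).

Lemma zeros_root b : b \in zeros P -> root (map_poly iota M) b.
Proof.
move=> bP; apply: MP; rewrite (zerosE P) rootZ ?lead_coef_eq0 //.
by rewrite root_prod_XsubC.
Qed.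

(** Otherwise all points [a] with [M(a)] nonzero contribute the same number of
    absolute value 1 to the sum [char_sum r], which is then too large for
    [char_sum_growth]. *)
Lemma nontrivial_residue : exists2 u : {poly k}, coprimep u M &
  chi (zeros_prod P (map_poly iota u)) != 1.
Proof.
have [t t_gt0 [c cP]] := char_sum_growth.
pose j := (c + 2 * size M).+1; pose r := (2 * t * j)%N; pose w := (q ^ (t * j))%N.
have j_w : (j < w)%N.
  apply: (@leq_trans (q ^ j)); first exact: ltn_expl.
  by rewrite leq_exp2l // leq_pmull.
have qr_gt1 : (1 < q ^ r)%N by rewrite -{1}(expn0 q) ltn_exp2l // !muln_gt0 t_gt0.
have ww : (w * w = q ^ r)%N by rewrite -expnD; congr (_ ^ _)%N; rewrite /r; ring.
pose X := frob_fixed F (q ^ r).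
pose good a := ~~ root (map_poly iota M) a.
pose u a := descend iota (cyc q r a).
have uE a : a \in X -> map_poly iota (u a) = cyc q r a.
  rewrite mem_frob_fixed // => /eqP aq; apply: descendK; exact: cyc_frob.
have u_coprime a : a \in X -> good a -> coprimep (u a) M.
  move=> aX ga; rewrite -(coprimep_map iota) uE //.
  apply: (big_ind (fun v => coprimep v (map_poly iota M))) => [|v1 v2 c1 c2|i _].
  - exact: coprime1p.
  - by rewrite coprimepMl c1.
  rewrite coprimep_sym coprimep_XsubC /root -(fixed_poly_horner (frob_map_iota iota M)).
  by rewrite expf_eq0 negb_and -[_ == 0]/(root _ _) (ga : ~~ root _ _) orbT.
have [/hasP [a aX /andP [ga ua]]|none] := boolP (has (fun a => good a &&
    (chi (zeros_prod P (map_poly iota (u a))) != 1)) X).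
  by exists (u a) => //; apply: u_coprime.
exfalso.
have trivial a : a \in X -> good a -> chi (zeros_prod P (map_poly iota (u a))) = 1.
  move=> aX ga; apply/eqP; apply: contraNT none => ua.
  by apply/hasP; exists a; rewrite ?ga.
pose K := chi (norm_const P ^+ r).
have K1 : `|K| = 1.
  apply: char_norm; last exact: (norm_const_fixed iota QE PQ).
  by rewrite expf_neq0 // mulf_neq0 ?lead_coef_eq0 // signr_eq0.
pose v a := chi (\prod_(i < r) P.[a ^+ (q ^ i)]).
have v_fixed a : a \in X ->
    (\prod_(i < r) P.[a ^+ (q ^ i)]) ^+ Q = \prod_(i < r) P.[a ^+ (q ^ i)].
  move=> aX; rewrite -(poly_norm_cyc k) -uE //.
  exact: (poly_norm_fixed QE P0 PQ (frob_map_iota iota _)).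
have v_good a : a \in X -> good a -> v a = K.
  move=> aX ga; rewrite /v -(poly_norm_cyc k) /poly_norm cyc_size /= charM.
  - by rewrite -uE // trivial // mulr1.
  - exact: (norm_const_fixed iota QE PQ).
  by rewrite -uE //; exact: (zeros_prod_fixed QE P0 PQ (frob_map_iota iota _)).
have : `|char_sum k chi P r - \sum_(a <- X | ~~ good a) v a| = (count good X)%:R.
  rewrite /char_sum -/X (bigID good) /= addrK big_seq_cond.
  rewrite (eq_bigr (fun=> K)) => [|a /andP [aX ga]]; last exact: v_good.
  by rewrite -big_seq_cond big_const_seq iter_addr_0 normrMn K1.
have bad : (count (predC good) X <= size M)%N.
  rewrite -size_filter -(size_map_poly iota M) ltnW // max_poly_roots ?map_poly_eq0 //.
    by apply/allP=> x; rewrite mem_filter /= => /andP [/negPn].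
  by rewrite filter_uniq // frob_fixed_uniq.
have := count_predC good X; rewrite size_frob_fixed ?pnatX ?qF //.
move: bad; set g := count good X; set b := count _ X => bM gb normE.
have : (g%:R : C) <= c%:R * w%:R + b%:R.
  rewrite -normE; apply: le_trans (ler_normB _ _) _; apply: lerD.
    by rewrite natrX exprM; apply: cP.
  apply: le_trans (ler_norm_sum _ _ _) _; rewrite big_seq_cond.
  apply: le_trans (ler_sum _ (_ : forall a, _ -> `|v a| <= 1)) _.
    by move=> a /andP [aX _]; apply/char_norm_le1/v_fixed.
  by rewrite -big_seq_cond big_const_seq iter_addr_0 lexx.
rewrite -natrM -natrD ler_nat => g_le; move: gb j_w bM g_le; rewrite -ww /j.
move: (w) (g) (b) (size M) => w' g' b' m gb' j_w' bM' g_le'.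
have : (w' * w' <= c * w' + (m + m))%N.
  rewrite -gb'; apply: leq_trans (leq_add g_le' bM') _.
  by rewrite -addnA leq_add2l leq_add2r.
apply/negP; rewrite -ltnNge; apply: (@leq_trans ((c + (2 * m).+1) * w')).
  by rewrite mulnDl ltn_add2l addnn -mul2n; nia.
by rewrite leq_mul2r addnS ltnW ?orbT.
Qed.

Theorem poly_char_sum_bound (arch : forall x : C, exists n, `|x| <= n%:R) :
  `|char_sum k chi P 1| <= ((size M).-1%:R - 1) * sqrtC q%:R.
Proof.
have [u uM u1] := nontrivial_residue.
have [s s_lt sE] := newton_unique (Lcoef0 iota char1 P)
  (Lcoef_vanish QE charM P0 PQ zeros_root M0 uM u1) (Lcoef_newton iota QE charM P0 PQ).
have [t t_gt0 [c cP]] := char_sum_growth.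
have q_gt0 : 0 < q%:R :> C by rewrite ltr0n ltnW.
have s_le w : w \in s -> `|w| <= sqrtC q%:R.
  move=> ws.
  have w2t : `|w ^+ (2 * t)| <= q%:R ^+ t.
    apply: (@power_sum_bound C arch [seq v ^+ (2 * t) | v <- s] c%:R).
    - by rewrite exprn_gt0.
    - move=> j j_gt0; rewrite big_map -normrN.
      rewrite (eq_bigr (fun v => v ^+ (2 * t * j))) => [|v _]; last by rewrite -exprM.
      by rewrite -sE ?muln_gt0 ?t_gt0 ?j_gt0 // cP.
    exact: map_f.
  rewrite -(@ler_pXn2r _ 2) ?nnegrE ?sqrtC_ge0 ?(ltW q_gt0) // sqrtCK.
  rewrite -(@ler_pXn2r _ t) ?nnegrE ?exprn_ge0 ?(ltW q_gt0) //.
  by rewrite -exprM -normrX.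
rewrite sE // normrN; apply: le_trans (ler_norm_sum _ _ _) _.
apply: (@le_trans _ _ ((size s)%:R * sqrtC q%:R)).
  rewrite big_seq; apply: le_trans (ler_sum _ (_ : forall w, _ -> _ <= sqrtC q%:R)) _.
    by move=> w /s_le; rewrite expr1.
  by rewrite -big_seq big_const_seq count_predT iter_addr_0 mulr_natl.
by rewrite ler_wpM2r ?sqrtC_ge0 ?(ltW q_gt0) // lerBrDr natr1 ler_nat.
Qed.

End CharacterSums.

(** * Rational functions and their factorizations *)

Local Open Scope complex_scope.

Lemma complex_archimedean (R : realType) (x : R[i]) : exists n : nat, `|x| <= n%:R.
Proof.
exists (Num.bound (complex.Re `|x|)).
have /RRe_real <- : `|x| \is Num.real by apply: normr_real.
rewrite -(rmorph_nat (real_complex R)) lecR.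
apply: ltW; apply: archi_boundP; rewrite -lecR RRe_real ?normr_real //.
by rewrite rmorph0 normr_ge0.
Qed.

Lemma rf_map_quot (K F : fieldType) (iota : {rmorphism K -> F}) (a b : {poly K}) :
  b != 0 -> rf_map iota (tofrac a / tofrac b) =
            tofrac (map_poly iota a) / tofrac (map_poly iota b).
Proof.
move=> b0; rewrite /rf_map; set g := tofrac a / tofrac b.
have d0 := rf_den_neq0 g.
have E : a * rf_den g = rf_num g * b.
  apply/eqP; rewrite -tofrac_eq !tofracM -eqr_div ?tofrac_eq0 //.
  by rewrite -rf_numden.
apply/eqP; rewrite eqr_div ?tofrac_eq0 ?map_poly_eq0 // -!tofracM -!rmorphM /=.
by rewrite -E.
Qed.

Lemma tofrac_expz (K : fieldType) (u : {poly K}) (n : int) :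
  tofrac u ^ n = tofrac (u ^+ (if n is Posz m then m else 0)) /
                 tofrac (u ^+ (if n is Negz m then m.+1 else 0)).
Proof.
case: n => n; first by rewrite expr0 tofrac1 divr1 tofracXn.
by rewrite expr0 tofrac1 mul1r tofracXn NegzE exprnN.
Qed.

(** The factorization with the negative exponents moved to the other side, so
    that it can be evaluated at any point. *)
Lemma rf_prod_cross (K : fieldType) (k : nat) (fj : 'I_k -> {poly K}) (nj : 'I_k -> int)
    (c : K) (f : {fraction {poly K}}) :
  (forall j, fj j != 0) ->
  f = tofrac c%:P * \prod_(j < k) tofrac (fj j) ^ nj j ->
  rf_num f * \prod_(j < k) fj j ^+ (if nj j is Negz m then m.+1 else 0%N) =
  c%:P * \prod_(j < k) fj j ^+ (if nj j is Posz m then m else 0%N) * rf_den f.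
Proof.
move=> fj0 fE; apply/eqP; rewrite -tofrac_eq [X in _ == X]tofracM tofracM.
rewrite -eqr_div ?tofrac_eq0 ?rf_den_neq0 //; last first.
  by apply/prodf_neq0 => j _; rewrite expf_neq0.
rewrite -rf_numden {1}fE tofracM -mulrA; apply/eqP; congr (_ * _).
rewrite !rmorph_prod -prodf_div; apply: eq_bigr => j _; exact: tofrac_expz.
Qed.

Lemma rf_root_factor (K F : fieldType) (iota : {rmorphism K -> F}) (k : nat)
  (fj : 'I_k -> {poly K}) (nj : 'I_k -> int)
    (c : K) (f : {fraction {poly K}}) (b : F) : c != 0 -> 
  (forall j, fj j != 0) ->
  f = tofrac c%:P * \prod_(j < k) tofrac (fj j) ^ nj j ->
  root (map_poly iota (rf_num f * rf_den f)) b ->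
  root (map_poly iota (\prod_j fj j)) b.
Proof.
move=> c0 fj0 fE; have := congr1 (fun p => (map_poly iota p).[b]) (rf_prod_cross fj0 fE).
have co : coprimep (map_poly iota (rf_num f)) (map_poly iota (rf_den f)).
  by rewrite coprimep_map rf_coprime.
have pow_root (m : 'I_k -> nat) : (map_poly iota (\prod_(j < k) fj j ^+ m j)).[b] = 0 ->
    root (map_poly iota (\prod_j fj j)) b.
  rewrite /root !rmorph_prod !horner_prod => /eqP; rewrite !prodf_seq_eq0.
  case/hasP=> j _ /=; rewrite rmorphXn horner_exp expf_eq0 => /andP [_ jb].
  by apply/hasP; exists j => //=; rewrite mem_index_enum.
rewrite !rmorphM /= map_polyC !hornerM hornerC rootM => cross /orP [nb|db].
  move: cross; rewrite (rootP nb) mul0r => /esym/eqP.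
  rewrite !mulf_eq0 fmorph_eq0 (negPf c0) (negPf (coprimep_root co nb)) orbF.
  by move/eqP/pow_root.
move: cross; rewrite (rootP db) mulr0 => /eqP.
rewrite coprimep_sym in co; rewrite mulf_eq0 (negPf (coprimep_root co db)).
by move/eqP/pow_root.
Qed.

(** * Conjugates of a polynomial and multiplicative characters *)

(** [M] is the product of the [d] conjugates of [Phi] over [k]. *)
Lemma conjugate_product (F : closedFieldType) (k : finFieldType)
    (iota : {rmorphism k -> F}) (d : nat) (Phi : {poly F}) :
  (0 < d)%N -> Phi != 0 -> (forall i, Phi`_i ^+ (#|k| ^ d) = Phi`_i) ->
  exists M : {poly k}, [/\ M != 0, (size M).-1 = (d * (size Phi).-1)%N &
    forall b, root Phi b -> root (map_poly iota M) b].
Proof.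
move=> d_gt0 Phi0 Phid; pose qF := finField_pchar_nat iota.
have qFi i : [pchar F].-nat (#|k| ^ i)%N by rewrite pnatX qF.
pose conj i := map_poly (frob (qFi i)) Phi.
have conjS i : map_poly (frob qF) (conj i) = conj i.+1.
  by apply/polyP=> j; rewrite !coef_map /= /frob -exprM -expnSr.
have conj0 : conj 0 = Phi by apply/polyP=> j; rewrite coef_map /= /frob expr1.
have conjd : conj d = Phi by apply/polyP=> j; rewrite coef_map /= /frob Phid.
pose N := \prod_(i < d) conj i.
have NE : map_poly (frob qF) N = N.
  rewrite /N rmorph_prod /=; under eq_bigr => i _ do rewrite conjS.
  case: (d) d_gt0 conjd => // d' _ conjd.
  by rewrite big_ord_recr [RHS]big_ord_recl /= conjd conj0 mulrC.
exists (descend iota N); rewrite -(map_poly_eq0 iota) -(size_map_poly iota) descendK //.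
have conj_neq0 i : conj i != 0 by rewrite map_poly_eq0.
split=> [||b Phib]; first by apply/prodf_neq0.
  rewrite /N; elim: (d) => [|d' IHd]; first by rewrite big_ord0 size_poly1.
  rewrite big_ord_recr /=; pose u : {poly F} := \prod_(i < d') conj i.
  have u0 : u != 0 by apply/prodf_neq0.
  have su : (size u).-1 = (d' * (size Phi).-1)%N := IHd.
  transitivity (size (u * conj d')).-1; first by [].
  rewrite size_mul // size_map_poly mulSn -su.
  move: u0 Phi0; rewrite -!size_poly_gt0.
  by move: (size Phi) (size u) => a b; lia.
rewrite /N; case: (d) d_gt0 => // d' _.
by rewrite big_ord_recl rootM conj0 Phib.
Qed.

Lemma finField_generator (K : finFieldType) :
  exists2 g : K, #|K|.-1.-primitive_root g & forall x, x != 0 -> exists i, x = g ^+ i.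
Proof.
have K1 : (0 < #|K|.-1)%N by rewrite -subn1 subn_gt0 card_field_gt1.
have unity : forall x : K, x != 0 -> x ^+ #|K|.-1 = 1.
  move=> x x0; apply: (mulfI x0); rewrite -exprS prednK ?expf_card ?mulr1 //.
  by rewrite ltnW // card_field_gt1.
have /hasP [g _ gP] : has #|K|.-1.-primitive_root (enum (predC1 (0 : K))).
  apply: has_prim_root; rewrite ?enum_uniq //; last by rewrite -cardE cardC1.
  by apply/allP=> x; rewrite mem_enum unity_rootE => /unity ->.
exists g => // x x0.
have [i ->] := prim_rootP gP (unity x x0); by exists i.
Qed.

(** The character is determined by its value at a generator of the cyclic
    group, and its order is the order of that value. *)
Lemma mulchar_primitive (K : finFieldType) (E : fieldType) (chi : K -> E)
    (e : nat) (g : K) :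
  is_mulchar chi -> is_mulchar_ord chi e -> #|K|.-1.-primitive_root g ->
  (forall x, x != 0 -> exists i, x = g ^+ i) ->
  [/\ forall i, chi (g ^+ i) = chi g ^+ i, e.-primitive_root (chi g) &
      (e %| #|K|.-1)%N].
Proof.
move=> [chi_neq0 chiM] [e_gt0 chi_e e_min] gP gen.
have g0 : g != 0 by rewrite (prim_root_eq0 gP) -lt0n (prim_order_gt0 gP).
have chi1 : chi 1 = 1.
  apply: (mulfI (chi_neq0 1 (oner_neq0 _))).
  by rewrite mulr1 -chiM ?oner_neq0 // mulr1.
have chiX i : chi (g ^+ i) = chi g ^+ i.
  by elim: i => [|i IHi]; rewrite ?expr0 // !exprS chiM ?expf_neq0 // IHi.
have gE : e.-primitive_root (chi g).
  have [m mP me] := prim_order_exists e_gt0 (chi_e g g0).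
  suff -> : e = m by [].
  apply/eqP; rewrite eqn_leq (dvdn_leq e_gt0 me) andbT e_min ?(prim_order_gt0 mP) //.
  by move=> x /gen [i ->]; rewrite chiX exprAC (prim_expr_order mP) expr1n.
by split=> //; rewrite (prim_order_dvd gE) -chiX (prim_expr_order gP) chi1.
Qed.

(** * The bound for a rational function *)

Unset Implicit Arguments.
Set Strict Implicit.
Set Printing Implicit Defensive.

Theorem theorem4p5
  (p m q d : nat) (p_prime : prime p) (m_gt0 : (0 < m)%N)
  (q_def : q = (p ^ m)%N) (d_gt0 : (0 < d)%N)
  (* Fbar is an algebraic closure of F_p, and Fq, Fqd are its subfields with
     q and q^d elements *)
  (Fbar : closedFieldType) (iota_p : {rmorphism 'F_p -> Fbar})
  (Fbar_alg : forall x : Fbar, algebraicOver iota_p x)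
  (Fq Fqd : finFieldType) (card_Fq : #|Fq| = q) (card_Fqd : #|Fqd| = (q ^ d)%N)
  (iota_q : {rmorphism Fq -> Fqd}) (iota_qd : {rmorphism Fqd -> Fbar})
  (* Qlbar, the field of values of chi, comes with an isomorphism to the
     complex numbers; R is the field of real numbers *)
  (R : realType) (Qlbar : fieldType) (iotaC : {rmorphism Qlbar -> R[i]})
  (iotaC_iso : bijective iotaC)
  (f : {fraction {poly Fqd}}) (c : Fqd) (c_neq0 : c != 0)
  (k : nat) (fj : 'I_k -> {poly Fqd}) (nj : 'I_k -> int)
  (fj_irr : forall j, irreducible_poly (fj j))
  (nj_neq0 : forall j, nj j != 0)
  (f_fact : f = FracField.tofrac c%:P *
                \prod_(j < k) FracField.tofrac (fj j) ^ nj j)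
  (chi : Fqd -> Qlbar) (chi_char : is_mulchar chi)
  (ord_chi : nat) (ord_chiP : is_mulchar_ord chi ord_chi)
  (f_not_power :
     ~ exists h : {fraction {poly Fbar}},
         rf_map iota_qd (\prod_(i < d) rf_subst_exp (q ^ i)%N f) =
         h ^+ ord_chi) :
  `| iotaC (\sum_(a : Fq | ~~ rf_zero f (iota_q a) && ~~ rf_pole f (iota_q a))
              chi (rf_eval f (iota_q a))) |
  <= ((d * \sum_(j < k) (size (fj j)).-1)%N%:R - 1) * sqrtC (q%:R : R[i]).
Proof.
have cFqd : #|Fqd| = (#|Fq| ^ d)%N by rewrite card_Fqd card_Fq.
pose iota : {rmorphism Fq -> Fbar} := iota_qd \o iota_q.
have [g gP gen] := finField_generator Fqd.
have [chiX chi_prim eQ] := mulchar_primitive chi_char ord_chiP gP gen.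
pose e := ord_chi; pose E := (#|Fqd|.-1 %/ e)%N.
have eE : (e * E)%N = (#|Fq| ^ d).-1 by rewrite -cFqd mulnC divnK.
have e_gt0 : (0 < e)%N := prim_order_gt0 chi_prim.
pose theta := iota_qd (g ^+ E); pose xi := iotaC (chi g).
have thetaP : e.-primitive_root theta.
  by rewrite fmorph_primitive_root dvdn_prim_root.
have xiP : e.-primitive_root xi by rewrite fmorph_primitive_root.
pose chiF x : R[i] :=
  if [pick y | (iota_qd y == x) && (y != 0)] is Some y then iotaC (chi y) else 0.
have chiFE y : chiF (iota_qd y) = if y == 0 then 0 else iotaC (chi y).
  rewrite /chiF; case: pickP => [z /andP [/eqP /fmorph_inj -> /negPf -> //]|none].
  by have := none y; rewrite eqxx /=; case: eqP.
have chiF0 : chiF 0 = 0 by rewrite -(rmorph0 iota_qd) chiFE eqxx.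
have chiFP x : x != 0 -> x ^+ (#|Fq| ^ d) = x ->
    exists2 j, x ^+ E = theta ^+ j & chiF x = xi ^+ j.
  rewrite -cFqd => x0 /(fixed_iota iota_qd) [y xy]; move: x0.
  rewrite -xy fmorph_eq0 => y0; have [j yj] := gen y y0; exists j.
    by rewrite yj -!rmorphXn exprAC.
  by rewrite chiFE (negPf y0) yj chiX rmorphXn.
have fj0 j : fj j != 0 by apply: irredp_neq0.
have num0 : rf_num f != 0.
  have : f != 0.
    rewrite f_fact mulf_neq0 ?tofrac_eq0 ?polyC_eq0 //.
    by apply/prodf_neq0 => j _; rewrite expfz_neq0 ?tofrac_eq0.
  by apply: contraNneq => n0; rewrite (rf_numden f) n0 tofrac0 mul0r.
have den0 := rf_den_neq0 f.
(* [Pk] is [f] times an [e]-th power *)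
pose Pk := rf_num f * rf_den f ^+ e.-1; pose P := map_poly iota_qd Pk.
have P0 : P != 0 by rewrite map_poly_eq0 mulf_neq0 ?expf_neq0.
have PQ i : P`_i ^+ (#|Fq| ^ d) = P`_i.
  by rewrite coef_map -rmorphXn -cFqd expf_card.
(* if all multiplicities were divisible by [e], the product of the conjugates
   of [P] would be an [e]-th power, hence also that of the conjugates of [f],
   from which it differs by an [e]-th power *)
have [x0 not_power] : exists x0, ~~ (e %| mup x0 (twisted_prod Fq d P))%N.
  set G := twisted_prod Fq d P; have G0 : G != 0.
    apply/prodf_neq0 => i _; apply: comp_polyXn_neq0 => //.
    by rewrite expn_gt0 ltnW // card_field_gt1.
  have [s sE] := closed_field_poly_normal G.
  have [/hasP [x _ xG]|none] := boolP (has (fun x => ~~ (e %| mup x G)%N) s).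
    by exists x.
  have [x|H HG] := closed_field_poly_power e_gt0 G0.
    have [xs|xs] := boolP (x \in s).
      by apply: contraNT none => xG; apply/hasP; exists x.
    by rewrite mupNroot ?dvdn0 // sE rootZ ?lead_coef_eq0 // root_prod_XsubC.
  case: f_not_power.
  pose A := \prod_(i < d) (rf_num f \Po 'X^(q ^ i)).
  pose B := \prod_(i < d) (rf_den f \Po 'X^(q ^ i)).
  have B0 : B != 0.
    apply/prodf_neq0 => i _; apply: comp_polyXn_neq0 => //.
    by rewrite -card_Fq expn_gt0 ltnW // card_field_gt1.
  have fAB : \prod_(i < d) rf_subst_exp (q ^ i)%N f = tofrac A / tofrac B.
    by rewrite /rf_subst_exp prodf_div !rmorph_prod.
  have GAB : G = map_poly iota_qd (A * B ^+ e.-1).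
    rewrite /A /B -prodrXl -big_split rmorph_prod /=; apply: eq_bigr => i _.
    rewrite card_Fq rmorphM rmorphXn /= !map_comp_poly map_polyXn.
    by rewrite /P /Pk rmorphM rmorphXn /= comp_polyM rmorphXn.
  exists (tofrac H / tofrac (map_poly iota_qd B)).
  rewrite fAB rf_map_quot // expr_div_n -!tofracXn HG GAB; apply/eqP.
  rewrite eqr_div ?tofrac_eq0 ?expf_neq0 ?map_poly_eq0 // -!tofracM.
  rewrite -rmorphXn -!rmorphM /= -mulrA -exprSr prednK //.
pose Phi := map_poly iota_qd (\prod_j fj j).
have Phi0 : Phi != 0 by rewrite map_poly_eq0; apply/prodf_neq0.
have Phi_fixed i : Phi`_i ^+ (#|Fq| ^ d) = Phi`_i.
  by rewrite coef_map -rmorphXn -cFqd expf_card.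
have [M [M0 sM MP]] := conjugate_product iota d_gt0 Phi0 Phi_fixed.
have MPP b : root P b -> root (map_poly iota M) b.
  move=> Pb; apply: MP; apply: (rf_root_factor c_neq0 fj0 f_fact).
  move: Pb; rewrite /P /Pk !rmorphM rmorphXn /= !rootM => /orP [->//|].
  by rewrite /root horner_exp expf_eq0 => /andP [_ ->]; rewrite orbT.
have := poly_char_sum_bound (erefl _) d_gt0 eE thetaP xiP chiF0 chiFP P0 PQ
  not_power M0 MPP (@complex_archimedean R).
have -> : char_sum Fq chiF P 1 = iotaC (\sum_(a : Fq | ~~ rf_zero f (iota_q a) &&
    ~~ rf_pole f (iota_q a)) chi (rf_eval f (iota_q a))).
  rewrite /char_sum expn1 rmorph_sum [RHS]big_mkcond /=.
  have permX : perm_eq (frob_fixed Fbar #|Fq|) (map iota (enum Fq)).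
    apply: uniq_perm; first exact: frob_fixed_uniq.
      by rewrite map_inj_uniq ?enum_uniq //; apply: fmorph_inj.
    move=> x; rewrite mem_frob_fixed ?card_field_gt1 //.
    apply/eqP/mapP => [/(fixed_iota iota) [y <-]|[y _ ->]]; last exact: iota_fixed.
    by exists y; rewrite ?mem_enum.
  rewrite (perm_big _ permX) big_map big_enum /=; apply: eq_bigr => a _.
  rewrite big_ord1 expn0 expr1 /iota /=; set b := iota_q a.
  rewrite horner_map chiFE hornerM horner_exp mulf_eq0 expf_eq0 /rf_zero /rf_pole /root.
  (* [e] is not 1, so that the poles of [f] are zeros of [P] *)
  have e_gt1 : (0 < e.-1)%N.
    rewrite -ltnS prednK // ltn_neqAle e_gt0 andbT eq_sym.
    by apply: contraNneq not_power => ->; rewrite dvd1n.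
  rewrite e_gt1 /= -negb_or; case: ifP => //= /negbT; rewrite negb_or => /andP [nb db].
  congr (iotaC _); rewrite /rf_eval; have [chi_neq0 chiM] := chi_char.
  have -> : (rf_num f).[b] * (rf_den f).[b] ^+ e.-1 =
      (rf_num f).[b] / (rf_den f).[b] * (rf_den f).[b] ^+ e.
    by rewrite -{2}(prednK e_gt0) exprS mulrA mulfVK.
  have [_ chi_e _] := ord_chiP.
  have chi_den : chi ((rf_den f).[b] ^+ e) = 1.
    have [j dj] := gen _ db; move: db; rewrite /root dj => db.
    by rewrite -exprM chiX exprM -chiX chi_e.
  by rewrite chiM ?expf_neq0 ?mulf_neq0 ?invr_eq0 // chi_den mulr1.
rewrite card_Fq => /le_trans; apply.
rewrite ler_wpM2r ?sqrtC_ge0 ?ler0n // lerB // ler_nat sM leq_mul2l.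
rewrite -ltnS prednK ?size_poly_gt0 // size_map_poly; apply/orP; right.
by apply: size_prod_bound => j; apply: leqSpred.
Qed.
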